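(* Let $f$ be a partial map from a set $X$ to itself with a single orbit. Then $(X,f)$ is unary FA-presentable if and only if its graph can be obtained in one of the following ways: (1) Start with a finite directed cycle; attach finitely many inward rooted finite trees (at their roots) to the cycle; then to any vertices of the resulting finite graph attach finitely many inwardly oriented periodic paths (at their bases) and finitely many inwardly oriented shallow stars (at their centres). (2) Start with an inward rooted finite tree; to the root attach one outwardly oriented periodic path (at its base); then to any vertices of the resulting graph attach finitely many inwardly oriented periodic paths (at their bases) and finitely many inwardly oriented shallow stars (at their centres). (3) Start with an inward rooted finite tree; to any vertices of it attach finitely many inwardly oriented periodic paths (at their bases) and finitely many inwardly oriented shallow stars (at their centres).
   Context: The graph of a partial map $f:X\to X$ is the directed graph with vertex set $X$ and edges $(x,(x)f)$ for those $x$ with $(x)f$ defined; orbits are the connected components of this graph. $(X,f)$ is unary FA-presentable if there exist a regular language $L\subseteq a^*$ and a surjection $\phi:L\to X$ such that $\{(u,v)\in L^2:u\phi=v\phi\}$ and $\{(u,v)\in L^2:(u\phi)f=v\phi\}$ are regular relations (words $\mathrm{conv}(u,v)$ over $\{a,\$\}^2$, reading $u,v$ in parallel with the shorter padded by $\$$, form regular languages). Attaching $(T,\eta)$ at $t$ to a vertex $g$ of $(G,\gamma)$: take the disjoint union and identify $g$ with $t$. An inward rooted tree is a directed tree with a distinguished root such that every edge points towards the root. A template is $(T,\eta,t_0,t_1)$, $(T,\eta)$ a finite directed tree, $t_0,t_1\in T$, $t_0$ a leaf; $\mathcal{S}(T,\eta,t_0,t_1)$ is obtained from disjoint copies $(T^{(j)},\eta^{(j)},t^{(j)}_0,t^{(j)}_1)$,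 $j\ge0$, by identifying according to the equivalence relation generated by $\{(t_1^{(j)},t_0^{(j+1)})\}$. If $t_0=t_1$ it is a shallow star with centre the amalgamated vertex, inwardly oriented if every template edge is oriented towards $t_0$. If $t_0\neq t_1$ it is a periodic path with base $t_0^{(0)}$, inwardly oriented if every template edge is oriented towards $t_0$, outwardly oriented if every template edge is oriented towards $t_1$. *)

(* Defs.v *)
From Stdlib Require Import Relations.
From mathcomp Require Import all_boot.
Set Implicit Arguments.
Unset Strict Implicit.
Unset Printing Implicit Defensive.

Definition graph_edge {X : Type} (f : X -> option X) (x y : X) : Prop :=
  f x = Some y.

Definition single_orbit {X : Type} (f : X -> option X) : Prop :=
  inhabited X /\ forall x y : X, clos_refl_sym_trans X (graph_edge f) x y.

Record dfa (A : finType) := DFA {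
  dstate : finType;
  dstart : dstate;
  dfinal : pred dstate;
  dtrans : dstate -> A -> dstate }.

Definition dfa_accepts (A : finType) (d : dfa A) (w : seq A) : bool :=
  @dfinal A d (foldl (@dtrans A d) (@dstart A d) w).

Definition regular (A : finType) (L : seq A -> Prop) : Prop :=
  exists d : dfa A, forall w, L w <-> dfa_accepts d w.

(* padded letter: None stands for the padding symbol $ *)
Definition pad_nth (A : Type) (u : seq A) (i : nat) : option A :=
  if i < size u then ohead (drop i u) else None.

Definition conv (A : Type) (u v : seq A) : seq (option A * option A) :=
  mkseq (fun i => (pad_nth u i, pad_nth v i)) (maxn (size u) (size v)).

(* Unary alphabet {a} is [unit]; {a,$}^2 is (option unit * option unit). *)
Definition unary_FA_presentable {X : Type} (f : X -> option X) : Prop :=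
  exists (L : seq unit -> Prop) (phi : {w : seq unit | L w} -> X),
    regular L /\
    (forall x : X, exists u, phi u = x) /\
    regular (fun c : seq (option unit * option unit) =>
               exists u v : {w : seq unit | L w},
                 phi u = phi v /\ c = conv (proj1_sig u) (proj1_sig v)) /\
    regular (fun c : seq (option unit * option unit) =>
               exists u v : {w : seq unit | L w},
                 f (phi u) = Some (phi v) /\ c = conv (proj1_sig u) (proj1_sig v)).

(* A glued graph: a vertex type, a directed edge relation, and a relation
   generating the identification of vertices.  The graph it denotes has as
   vertices the classes of the equivalence relation generated by gG, with an
   edge [u] -> [v] iff some u' in [u], v' in [v] have gE u' v'. *)
Record ggraph := GGraph {
  gV : Type;
  gE : gV -> gV -> Prop;
  gG : gV -> gV -> Prop }.

Definition geqv (g : ggraph) : gV g -> gV g -> Prop :=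
  clos_refl_sym_trans (gV g) (@gG g).

Definition qedge (g : ggraph) (u v : gV g) : Prop :=
  exists u' v', geqv u u' /\ geqv v v' /\ gE u' v'.

Definition graph_iso {X : Type} (f : X -> option X) (g : ggraph) : Prop :=
  exists psi : gV g -> X,
    (forall x : X, exists u, psi u = x) /\
    (forall u v, psi u = psi v <-> geqv u v) /\
    (forall u v, f (psi u) = Some (psi v) <-> qedge u v).

Inductive sigrel (k : nat) (P : 'I_k -> ggraph)
    (R : forall i, gV (P i) -> gV (P i) -> Prop) :
    {i : 'I_k & gV (P i)} -> {i : 'I_k & gV (P i)} -> Prop :=
  sigrel_in i u v : R i u v -> sigrel R (existT _ i u) (existT _ i v).

Definition multi_attach (K : ggraph) (k : nat) (P : 'I_k -> ggraph)
    (p : forall i, gV (P i)) (a : 'I_k -> gV K) : ggraph :=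
  GGraph
    (fun x y : (gV K + {i : 'I_k & gV (P i)})%type =>
       match x, y with
       | inl u, inl v => gE u v
       | inr s, inr t => sigrel (fun i => @gE (P i)) s t
       | _, _ => False
       end)
    (fun x y : (gV K + {i : 'I_k & gV (P i)})%type =>
       match x, y with
       | inl u, inl v => gG u v
       | inr s, inr t => sigrel (fun i => @gG (P i)) s t
       | inl u, inr (existT i w) => u = a i /\ w = p i
       | _, _ => False
       end).

Arguments multi_attach K {k} P p a.

Definition iter_opt (T : Type) (eta : T -> option T) (n : nat) (x : T) : option T :=
  iter n (fun o => obind eta o) (Some x).

(* (T, eta) is an inward rooted tree with root r: a directed tree every edge of
   which points towards r; for the graph of a partial map this says r has no
   out-edge and every vertex reaches r by following edges. *)
Definition inward_rooted (T : Type) (eta : T -> option T) (r : T) : Prop :=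
  eta r = None /\ forall x, exists n, iter_opt eta n x = Some r.

Definition is_leaf (T : finType) (eta : T -> option T) (t : T) : bool :=
  #|[set x | (eta x == Some t) || (eta t == Some x)]| <= 1.

Record rtree := RTree {
  rT : finType;
  reta : rT -> option rT;
  rroot : rT }.

Definition rtree_ok (R : rtree) : Prop := inward_rooted (@reta R) (rroot R).

Definition tree_g (R : rtree) : ggraph :=
  GGraph (fun x y : rT R => reta x = Some y) (fun _ _ => False).

Definition cycle_g (n : nat) : ggraph :=
  GGraph (fun i j : 'I_n.+1 => val j = (val i).+1 %% n.+1) (fun _ _ => False).

Record template := Template {
  tT : finType;
  teta : tT -> option tT;
  tt0 : tT;
  tt1 : tT }.

(* every template edge oriented towards t0 (covers inwardly oriented
   periodic paths when t0 <> t1 and inwardly oriented shallow stars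
   when t0 = t1) *)
Definition inward_template (Q : template) : Prop :=
  inward_rooted (@teta Q) (tt0 Q) /\ is_leaf (@teta Q) (tt0 Q).

Definition outward_path_template (Q : template) : Prop :=
  tt0 Q <> tt1 Q /\ inward_rooted (@teta Q) (tt1 Q) /\ is_leaf (@teta Q) (tt0 Q).

Definition S_g (Q : template) : ggraph :=
  GGraph (fun x y : nat * tT Q => x.1 = y.1 /\ teta x.2 = Some y.2)
         (fun x y : nat * tT Q => y.1 = x.1.+1 /\ x.2 = tt1 Q /\ y.2 = tt0 Q).

Definition S_base (Q : template) : gV (S_g Q) := (0, tt0 Q).

Definition decorations_iso {X : Type} (f : X -> option X) (G : ggraph) : Prop :=
  exists (m : nat) (Q : 'I_m -> template) (b : 'I_m -> gV G),
    (forall i, inward_template (Q i)) /\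
    graph_iso f (multi_attach G (fun i => S_g (Q i)) (fun i => S_base (Q i)) b).

Definition shape1 {X : Type} (f : X -> option X) : Prop :=
  exists (n k : nat) (P : 'I_k -> rtree) (a : 'I_k -> 'I_n.+1),
    (forall i, rtree_ok (P i)) /\
    decorations_iso f
      (multi_attach (cycle_g n) (fun i => tree_g (P i))
                    (fun i => rroot (P i)) a).

Definition shape2 {X : Type} (f : X -> option X) : Prop :=
  exists (R : rtree) (O : template),
    rtree_ok R /\ outward_path_template O /\
    decorations_iso f
      (@multi_attach (tree_g R) 1 (fun _ => S_g O)
                    (fun _ => S_base O) (fun _ => rroot R)).

Definition shape3 {X : Type} (f : X -> option X) : Prop :=
  exists R : rtree, rtree_ok R /\ decorations_iso f (tree_g R).

(* Main.v *)
Require Import Defs.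
From mathcomp Require Import all_boot zify.
From mathcomp Require Import boolp.
From Stdlib Require Import Relations.
Set Implicit Arguments.
Unset Strict Implicit.
Unset Printing Implicit Defensive.

(** A binary relation on unary words is regular iff it is ultimately periodic in the
    length of the common prefix and in the length difference. Hence, after passing to
    least representatives, a unary FA-presentable map acts on finitely many columns
    [beta b j], and for large [j] it sends a column either to a single vertex or to a
    column with a bounded shift of [j]; conversely such a map is presentable. On the
    finite functional graph of columns, summing the shifts along the way to a chosen
    root column re-indexes each component so that only the root shifts: towards lower
    levels (inward periodic paths, one per residue of the shift), to a single vertex
    (a shallow star), or to higher levels. A single orbit forces the last case to occur
    at most once and with shift one (the outward path), because families of levels that
    are closed under the map cannot be disjoint. What remains is a finite core: a tree
    or a cycle with trees. *)

(** * Regular binary relations on unary words *)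

(** Both bounds on the shift come from pumping least representatives. A vertex has one successor, so
    no edge leads to a much longer word: pumping the target alone would give a second successor. If
    the target is much shorter, the source alone can be pumped, which yields the columns with a
    single target. Otherwise the lengths differ by less than the threshold; a period above the
    threshold turns this into a shift by at most one level, stored as 0, 1 or 2. The single orbit
    enters through confluence: any two vertices have a common iterate. The main obstacle is that
    finitely many edges obey no law. They are pushed into the core by starting every column late
    enough, and the starting points must vary from column to column for the shifts along non-root
    columns to vanish. Identifications in glued graphs are controlled by maps whose kernel is
    exactly the generated equivalence. *)

Definition biper (R : nat -> nat -> Prop) (N p : nat) : Prop :=
  [/\ forall m n, N <= m -> N <= n -> (R m n <-> R (m + p) (n + p)),
      forall m n, m + N <= n -> (R m n <-> R m (n + p))
    & forall m n, n + N <= m -> (R m n <-> R (m + p) n)].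

Lemma biper_le (R : nat -> nat -> Prop) N N' p :
  N <= N' -> biper R N p -> biper R N' p.
Proof.
move=> le_N [H1 H2 H3]; split=> m n *; [apply: H1|apply: H2|apply: H3]; lia.
Qed.

Lemma biper_mul (R : nat -> nat -> Prop) N p q :
  biper R N p -> biper R N (p * q).
Proof.
move=> [H1 H2 H3]; elim: q => [|q [K1 K2 K3]]; first by rewrite muln0; split=> m n *; rewrite !addn0.
split=> m n *; rewrite mulnSr !addnA.
- by rewrite K1 // H1 //; lia.
- by rewrite K2 // H2 //; lia.
- by rewrite K3 // H3 //; lia.
Qed.

Definition uconv (m n : nat) : seq (option unit * option unit) :=
  conv (nseq m tt) (nseq n tt).

Lemma unary_word (w : seq unit) : w = nseq (size w) tt.
Proof. by elim: w => //= -[] w {1}->. Qed.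

Lemma pad_nth_nseq n i : pad_nth (nseq n tt) i = if i < n then Some tt else None.
Proof.
rewrite /pad_nth size_nseq; case: ltnP => // lt_in.
by rewrite drop_nseq; case: (n - i) (subn_gt0 i n) => //; rewrite lt_in.
Qed.

Lemma size_uconv m n : size (uconv m n) = maxn m n.
Proof. by rewrite size_mkseq !size_nseq. Qed.

Lemma nth_uconv m n i : i < maxn m n ->
  nth (None, None) (uconv m n) i =
    (if i < m then Some tt else None, if i < n then Some tt else None).
Proof. by move=> lt_i; rewrite nth_mkseq ?size_nseq // !pad_nth_nseq. Qed.

Lemma uconvDl k d :
  uconv (k + d) k = nseq k (Some tt, Some tt) ++ nseq d (Some tt, None).
Proof.
apply: (@eq_from_nth _ (None, None)) => [|i].
  by rewrite size_uconv size_cat !size_nseq; lia.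
rewrite size_uconv => lt_i; rewrite nth_uconv // nth_cat size_nseq !nth_nseq.
have -> : i < k + d by lia.
by case: ltnP => // le_ki; rewrite ltn_subLR // (_ : i < k + d) //; lia.
Qed.

Lemma uconvDr k d :
  uconv k (k + d) = nseq k (Some tt, Some tt) ++ nseq d (None, Some tt).
Proof.
apply: (@eq_from_nth _ (None, None)) => [|i].
  by rewrite size_uconv size_cat !size_nseq; lia.
rewrite size_uconv => lt_i; rewrite nth_uconv // nth_cat size_nseq !nth_nseq.
have -> : i < k + d by lia.
by case: ltnP => // le_ki; rewrite ltn_subLR // (_ : i < k + d) //; lia.
Qed.

Lemma nseq_rcons (T : Type) n (a : T) : rcons (nseq n a) a = nseq n.+1 a.
Proof. by elim: n => //= n ->. Qed.

Lemma uconvnn k : uconv k k = nseq k (Some tt, Some tt).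
Proof. by have := uconvDl k 0; rewrite addn0 cats0. Qed.

Lemma uconv_inj m n m' n' : uconv m n = uconv m' n' -> m = m' /\ n = n'.
Proof.
move=> E; have Es : maxn m n = maxn m' n' by rewrite -!size_uconv E.
have Ei i : i < maxn m n -> (i < m) = (i < m') /\ (i < n) = (i < n').
  move=> lt_i; have := congr1 (nth (None, None) ^~ i) E.
  by rewrite /= !nth_uconv -?Es //; do 4 case: ltnP => _.
have := Ei (minn m m'); have := Ei (minn n n').
by move=> A B; split; apply/eqP; rewrite eqn_leq; lia.
Qed.

Definition uregular (R : nat -> nat -> Prop) : Prop :=
  regular (fun c => exists m n, R m n /\ c = uconv m n).

Lemma foldl_nseq (T S : Type) (h : T -> S -> T) n a x :
  foldl h x (nseq n a) = iter n (h^~ a) x.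
Proof. by elim: n x => //= n IHn x; rewrite IHn -iterSr. Qed.

(** The orbit of [q] enters its cycle within [#|Q|] steps, and the length of the cycle is at most
    [#|Q|], so it divides the factorial. *)
Lemma iter_periodic (Q : finType) (g : Q -> Q) (q : Q) n k :
  #|Q| <= n -> iter (n + #|Q|`! * k) g q = iter n g q.
Proof.
move=> le_n; have le_o : fingraph.order g q <= #|Q| by apply: max_card.
have /trajectP[i lt_i Ei] := looping_order g q.
have per m : i <= m -> iter (m + (fingraph.order g q - i)) g q = iter m g q.
  move=> le_im; have -> : m + (fingraph.order g q - i) = m - i + fingraph.order g q by lia.
  by rewrite iterD Ei -iterD subnK.
have /dvdnP[c ->] : fingraph.order g q - i %| #|Q|`! by apply: dvdn_fact; lia.
rewrite mulnAC; elim: (c * k) => [|l IH]; first by rewrite addn0.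
by rewrite mulSn addnA addnAC per ?IH //; lia.
Qed.

(** A convolution is a block of (a,a) followed by a block of ($,a) or of (a,$). Each block iterates
    one transition, so [iter_periodic] pumps it; the three clauses of [biper] correspond to the
    three blocks. *)
Lemma uregular_biper (R : nat -> nat -> Prop) :
  uregular R -> exists N p, 0 < p /\ biper R N p.
Proof.
case=> D HD; exists #|dstate D|, (#|dstate D|`!); split; first exact: fact_gt0.
have HR m n : R m n <-> dfa_accepts D (uconv m n).
  rewrite -HD; split=> [Rmn|[m' [n' [Rmn /uconv_inj[-> ->]]]] //].
  by exists m, n.
have per (g : dstate D -> dstate D) q n : #|dstate D| <= n ->
    iter (n + #|dstate D|`!) g q = iter n g q.
  by move=> le_n; have := @iter_periodic _ g q n 1 le_n; rewrite muln1.
split=> m n; rewrite !HR /dfa_accepts.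
- move=> le_m le_n; case: (leqP m n) => [le_mn|/ltnW le_nm].
    rewrite -(subnKC le_mn) addnAC !uconvDr !foldl_cat !foldl_nseq per //.
  by rewrite -(subnKC le_nm) addnAC !uconvDl !foldl_cat !foldl_nseq per.
- move=> le_n; rewrite -{1 2}(@subnKC m n); last by lia.
  by rewrite -addnA !uconvDr !foldl_cat !foldl_nseq per //; lia.
- move=> le_n; rewrite -{1 2}(@subnKC n m); last by lia.
  by rewrite -addnA !uconvDl !foldl_cat !foldl_nseq per //; lia.
Qed.

(** * Automata for ultimately periodic relations *)

Lemma regular_ext (A : finType) (L L' : seq A -> Prop) :
  (forall w, L w <-> L' w) -> regular L -> regular L'.
Proof. by move=> LL' [D HD]; exists D => w; rewrite -LL'. Qed.

(** The values of [h] serve as states, as in the Myhill-Nerode theorem. [acc] may be any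
    proposition, since classical logic decides it. *)
Lemma regular_of_quotient (A Q : finType) (L : seq A -> Prop) (h : seq A -> Q)
    (step : Q -> A -> Q) (acc : Q -> Prop) :
  (forall w a, h (rcons w a) = step (h w) a) ->
  (forall w, L w <-> acc (h w)) -> regular L.
Proof.
move=> hS hL; exists (@DFA A Q (h [::]) (fun q => `[< acc q >]) step) => w.
rewrite hL /dfa_accepts /=.
suff -> : foldl step (h [::]) w = h w by split=> /asboolP.
by elim/last_ind: w => // w a IH; rewrite foldl_rcons IH hS.
Qed.

(** Representative of [n] in the quotient of the naturals with preperiod [N] and period [p];
    successor descends to it by [redS]. *)
Definition red (N p n : nat) : nat := if n < N then n else N + (n - N) %% p.

Section Reduce.
Variables (N p : nat).
Hypotheses (N_gt0 : 0 < N) (p_gt0 : 0 < p).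

Lemma red_lt n : red N p n < N + p.
Proof.
rewrite /red; case: (ltnP n N) => [|_]; first by lia.
by rewrite ltn_add2l ltn_mod.
Qed.

Lemma red_periodic (P : nat -> Prop) n :
  (forall m, N <= m -> (P m <-> P (m + p))) -> (P n <-> P (red N p n)).
Proof.
move=> HP; rewrite /red; case: ltnP => // le_Nn.
rewrite -{1}(subnKC le_Nn) {1}(divn_eq (n - N) p).
elim: (_ %/ _) => [|l IH]; first by rewrite mul0n.
by rewrite -IH mulSn -!addnA (addnC p) !addnA -HP // -addnA leq_addr.
Qed.

Lemma redS n : red N p (red N p n).+1 = red N p n.+1.
Proof.
rewrite {2}/red; case: ltnP => // le_Nn.
rewrite /red !ltnNge (leqW le_Nn) (_ : N <= _.+1) /=; last by lia.
rewrite subSn ?leq_addr // addKn subSn //; congr (_ + _).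
by rewrite -addn1 modnDml addn1.
Qed.

Lemma redK n : red N p (red N p n) = red N p n.
Proof.
rewrite {2 3}/red; case: (ltnP n N) => [lt_n|_]; first by rewrite /red lt_n.
by rewrite /red ltnNge leq_addr /= addKn modn_mod.
Qed.

(** As [0 < N], zero is alone in its class, so the tests [d == 0] and [e == 0] of [cstep] can be
    made on reduced counters. *)
Lemma red_eq0 n : (red N p n == 0) = (n == 0).
Proof. by rewrite /red; case: ltnP; lia. Qed.

Definition ored (n : nat) : 'I_(N + p).+1 := inord (red N p n).

Lemma oredE n : ored n = red N p n :> nat.
Proof. by rewrite inordK // ltnS ltnW // red_lt. Qed.

Lemma regular_periodic (P : nat -> Prop) :
  (forall m, N <= m -> (P m <-> P (m + p))) -> regular (fun w : seq unit => P (size w)).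
Proof.
move=> HP; apply: (@regular_of_quotient _ _ _ (fun w => ored (size w))
  (fun q _ => ored q.+1) (fun q => P q)) => w.
  by move=> a; apply: ord_inj; rewrite size_rcons !oredE redS.
by rewrite oredE; apply: red_periodic.
Qed.

(* The triple [(k, d, e)] stands for the words (a,a)^k (a,$)^d (when e = 0) and
   (a,a)^k ($,a)^e (when d = 0). *)
Definition cstep (st : option (nat * nat * nat)) (l : option unit * option unit) :=
  if st is Some (k, d, e) then
    match l with
    | (Some _, Some _) => if (d == 0) && (e == 0) then Some (k.+1, d, e) else None
    | (Some _, None) => if e == 0 then Some (k, d.+1, e) else None
    | (None, Some _) => if d == 0 then Some (k, d, e.+1) else None
    | (None, None) => None
    end
  else None.

Definition cread := foldl cstep (Some (0, 0, 0)).

Lemma cread_uconv m n : cread (uconv m n) = Some (minn m n, m - n, n - m).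
Proof.
have it1 k : iter k (cstep^~ (Some tt, Some tt)) (Some (0, 0, 0)) = Some (k, 0, 0).
  by elim: k => //= k ->.
have it2 k d : iter d (cstep^~ (Some tt, None)) (Some (k, 0, 0)) = Some (k, d, 0).
  by elim: d => //= d ->.
have it3 k d : iter d (cstep^~ (None, Some tt)) (Some (k, 0, 0)) = Some (k, 0, d).
  by elim: d => //= d ->.
rewrite /cread; case: (leqP m n) => [le_mn|/ltnW le_nm].
  rewrite -{1}(subnKC le_mn) uconvDr foldl_cat !foldl_nseq it1 it3; congr (Some (_, _, _)); lia.
by rewrite -{1}(subnKC le_nm) uconvDl foldl_cat !foldl_nseq it1 it2; congr (Some (_, _, _)); lia.
Qed.

Lemma creadP w k d e : cread w = Some (k, d, e) ->
  w = uconv (k + d) (k + e) /\ (d = 0 \/ e = 0).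
Proof.
elim/last_ind: w k d e => [|w l IH] k d e.
  by move=> [<- <- <-]; split; [|left].
rewrite /cread foldl_rcons -/(cread w).
case: (cread w) IH => //= -[[k' d'] e'] /(_ _ _ _ erefl)[-> de].
case: l => [[[]|] [[]|]] //=.
- case: ifP => // /andP[/eqP-> /eqP->] [<- <- <-]; split; last by left.
  by rewrite !addn0 !uconvnn nseq_rcons.
- case: ifP => // /eqP-> [<- <- <-]; split; last by right.
  by rewrite !addn0 !uconvDl rcons_cat nseq_rcons.
- case: ifP => // /eqP-> [<- <- <-]; split; last by left.
  by rewrite !addn0 !uconvDr rcons_cat nseq_rcons.
Qed.

(** The automaton keeps the three counters of [cread], each reduced by [red]. Clause two or three of
    [biper] reduces the surplus with the common prefix fixed; clause one then reduces the prefix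
    with the reduced surplus fixed. *)
Lemma biper_uregular (R : nat -> nat -> Prop) : biper R N p -> uregular R.
Proof.
move=> [H1 H2 H3].
pose ored3 (x : nat * nat * nat) := (ored x.1.1, ored x.1.2, ored x.2).
pose oval3 (x : 'I_(N + p).+1 * 'I_(N + p).+1 * 'I_(N + p).+1) :=
  (x.1.1 : nat, x.1.2 : nat, x.2 : nat).
apply: (@regular_of_quotient _ _ _ (fun w => omap ored3 (cread w))
  (fun q l => omap ored3 (cstep (omap oval3 q) l))
  (fun q => if q is Some (k, d, e) then R (k + d) (k + e) else False)) => w.
  move=> l; rewrite /cread foldl_rcons -/(cread w).
  have oS n : ored (red N p n).+1 = ored n.+1.
    by apply: ord_inj; rewrite !oredE redS.
  have oK n : ored (red N p n) = ored n.
    by apply: ord_inj; rewrite !oredE redK.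
  case: (cread w) => [[[k d] e]|] //=; rewrite !oredE !red_eq0.
  by case: l => [[[]|] [[]|]] //=; case: ifP => //= _; rewrite /ored3 /= ?oS ?oK.
split=> [[m [n [Rmn ->]]]|].
  rewrite cread_uconv /=; rewrite !oredE.
  have [le_mn|/ltnW le_nm] := leqP m n.
    have -> : m - n = 0 by lia.
    rewrite /red N_gt0 -/(red N p m) -/(red N p (n - m)) addn0.
    rewrite -(@red_periodic (fun x => R x (x + red N p (n - m)))).
      rewrite -(@red_periodic (fun x => R m (m + x))) ?subnKC // => x le_x.
      by rewrite addnA -H2 // leq_add2l.
    move=> x le_x; rewrite addnAC -H1 //; lia.
  have -> : n - m = 0 by lia.
  rewrite /red N_gt0 -/(red N p n) -/(red N p (m - n)) addn0.
  rewrite -(@red_periodic (fun x => R (x + red N p (m - n)) x)).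
    rewrite -(@red_periodic (fun x => R (n + x) n)) ?subnKC // => x le_x.
    by rewrite addnA -H3 // leq_add2l.
  by move=> x le_x; rewrite addnAC -H1 //; lia.
case E: (cread w) => [[[k d] e]|] //=; have [-> de] := creadP E; rewrite !oredE.
move=> HR; exists (k + d), (k + e); split=> //; case: de HR => ->.
  rewrite /red N_gt0 -/(red N p k) -/(red N p e) !addn0.
  rewrite -(@red_periodic (fun x => R x (x + red N p e))).
    rewrite -(@red_periodic (fun x => R k (k + x))) // => x le_x.
    by rewrite addnA -H2 // leq_add2l.
  by move=> x le_x; rewrite addnAC -H1 //; lia.
rewrite /red N_gt0 -/(red N p k) -/(red N p d) !addn0.
rewrite -(@red_periodic (fun x => R (x + red N p d) x)).
  rewrite -(@red_periodic (fun x => R (k + x) k)) // => x le_x.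
  by rewrite addnA -H3 // leq_add2l.
by move=> x le_x; rewrite addnAC -H1 //; lia.
Qed.
End Reduce.

(** * Presentations by natural numbers *)

Definition nu_eq (X : Type) (nu : nat -> option X) (m n : nat) : Prop :=
  exists x, nu m = Some x /\ nu n = Some x.

Definition nu_edge (X : Type) (f : X -> option X) (nu : nat -> option X) (m n : nat) : Prop :=
  exists x y, [/\ nu m = Some x, nu n = Some y & f x = Some y].

Definition nat_presentation (X : Type) (f : X -> option X)
    (nu : nat -> option X) (N p : nat) : Prop :=
  [/\ 0 < p, forall x, exists n, nu n = Some x,
      biper (nu_eq nu) N p & biper (nu_edge f nu) N p].

(** A word over one letter is its length, so a presentation is a naming [nu] of vertices by numbers,
    undefined off the language. A maximum of thresholds and a product of periods serve both
    relations at once. *)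
Lemma FA_nat_presentation (X : Type) (f : X -> option X) :
  unary_FA_presentable f <-> exists nu N p, nat_presentation f nu N p.
Proof.
split=> [[L [phi [regL [surj [regE regF]]]]]|[nu [N [p [p_gt0 surj bE bF]]]]].
  pose nu n := if pselect (L (nseq n tt)) is left Ln then Some (phi (exist _ _ Ln)) else None.
  have nuP n x : nu n = Some x <-> exists h : L (nseq n tt), phi (exist _ _ h) = x.
    rewrite /nu; case: pselect => [Ln|nLn]; last by split=> // -[].
    split=> [[<-]|[h <-]]; first by exists Ln.
    by rewrite (Prop_irrelevance Ln h).
  have nuE (u : {w | L w}) : nu (size (proj1_sig u)) = Some (phi u).
    case: u => w Lw /=; apply/nuP; move: Lw; rewrite (unary_word w) => Lw.
    by rewrite size_nseq; exists Lw.
  have convE (u v : {w | L w}) :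
      conv (proj1_sig u) (proj1_sig v) = uconv (size (proj1_sig u)) (size (proj1_sig v)).
    by rewrite /uconv -!unary_word.
  have [|N1 [p1 [p1_gt0 b1]]] := @uregular_biper (nu_eq nu).
    apply: regular_ext regE => c; split=> [[u [v [Ephi ->]]]|[m [n [[x [/nuP[hm Em] /nuP[hn En]]] ->]]]].
      by exists (size (proj1_sig u)), (size (proj1_sig v)); split=> //; exists (phi u); rewrite {2}Ephi !nuE.
    by exists (exist _ _ hm), (exist _ _ hn); rewrite Em En.
  have [|N2 [p2 [p2_gt0 b2]]] := @uregular_biper (nu_edge f nu).
    apply: regular_ext regF => c; split=> [[u [v [Ephi ->]]]|[m [n [[x [y [/nuP[hm Em] /nuP[hn En] fxy]]] ->]]]].
      exists (size (proj1_sig u)), (size (proj1_sig v)); split=> //.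
      by exists (phi u), (phi v); rewrite !nuE.
    by exists (exist _ _ hm), (exist _ _ hn); rewrite Em En.
  exists nu, (maxn N1 N2), (p1 * p2); split; first by rewrite muln_gt0 p1_gt0.
  - by move=> x; have [u <-] := surj x; exists (size (proj1_sig u)).
  - by apply: biper_le (biper_mul p2 b1); rewrite leq_maxl.
  - by rewrite mulnC; apply: biper_le (biper_mul p1 b2); rewrite leq_maxr.
pose L (w : seq unit) : Prop := exists x, nu (size w) = Some x.
pose phi (u : {w | L w}) : X := projT1 (cid (proj2_sig u)).
have phiP u : nu (size (proj1_sig u)) = Some (phi u) := projT2 (cid (proj2_sig u)).
have Lnu n x : nu n = Some x -> exists u : {w | L w}, proj1_sig u = nseq n tt /\ phi u = x.
  move=> En; have Ln : L (nseq n tt) by exists x; rewrite size_nseq.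
  exists (exist _ _ Ln); split=> //.
  by have := phiP (exist _ _ Ln); rewrite /= size_nseq En => -[].
have convE (u v : {w | L w}) :
    conv (proj1_sig u) (proj1_sig v) = uconv (size (proj1_sig u)) (size (proj1_sig v)).
  by rewrite /uconv -!unary_word.
(* The automata need a positive threshold. *)
have bE' := biper_le (leqnSn N) bE; have bF' := biper_le (leqnSn N) bF.
exists L, phi; split.
  (* The language is the diagonal of [nu_eq], so clause one makes it periodic. *)
  apply: (@regular_periodic N.+1 p isT p_gt0 (fun n => exists x, nu n = Some x)) => m le_m.
  case: bE' => [H1 _ _]; have {}H1 := H1 m m le_m le_m.
  split=> [[x Ex]|[x Ex]].
    by have [|y [Ey _]] := (proj1 H1); [exists x | exists y].
  by have [|y [Ey _]] := (proj2 H1); [exists x | exists y].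
split; first by move=> x; have [n /Lnu[u [_ <-]]] := surj x; exists u.
split.
  apply: (regular_ext _ (@biper_uregular N.+1 p isT p_gt0 _ bE')) => c.
  split=> [[m [n [[x [/Lnu[u [Eu pu]] /Lnu[v [Ev pv]]]] ->]]]|[u [v [Euv ->]]]].
    by exists u, v; rewrite pu pv Eu Ev.
  by rewrite convE; exists (size (proj1_sig u)), (size (proj1_sig v)); split; [exists (phi u); rewrite {2}Euv !phiP|].
apply: (regular_ext _ (@biper_uregular N.+1 p isT p_gt0 _ bF')) => c.
split=> [[m [n [[x [y [/Lnu[u [Eu pu]] /Lnu[v [Ev pv]] fxy]]] ->]]]|[u [v [Euv ->]]]].
  by exists u, v; rewrite pu pv Eu Ev.
by rewrite convE; exists (size (proj1_sig u)), (size (proj1_sig v)); split; [exists (phi u), (phi v); rewrite !phiP|].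
Qed.

(** * Single orbits *)

Section Orbit.
Variables (X : Type) (f : X -> option X).

Lemma iter_optS n x : iter_opt f n.+1 x = obind (iter_opt f n) (f x).
Proof.
elim: n => [|n IH]; first by rewrite /iter_opt /=; case: (f x).
by rewrite {1}/iter_opt iterS -/(iter_opt f n.+1 x) IH; case: (f x).
Qed.

Lemma iter_opt_closed (P : X -> Prop) n x z :
  (forall u v, P u -> f u = Some v -> P v) ->
  iter_opt f n x = Some z -> P x -> P z.
Proof.
move=> Pf; elim: n x => [|n IH] x; first by move=> [->].
rewrite iter_optS; case E: (f x) => [y|] //= /IH Hz Px.
exact: Hz (Pf _ _ Px E).
Qed.

Lemma iter_opt_add m n x y :
  iter_opt f n x = Some y -> iter_opt f (m + n) x = iter_opt f m y.
Proof. by rewrite /iter_opt iterD => ->. Qed.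

(** Each vertex has at most one out-edge, so two merging pairs that share [y] are combined by
    prolonging the shorter of the two paths from [y]. *)
Lemma orbit_merge x y : clos_refl_sym_trans X (graph_edge f) x y ->
  exists m n z, iter_opt f m x = Some z /\ iter_opt f n y = Some z.
Proof.
elim=> {x y} [x y fxy|x|x y _ [m [n [z [Ex Ey]]]]|
    x y w _ [m [n [z [Ex Ey]]]] _ [m' [n' [z' [Ey' Ew]]]]].
- by exists 1, 0, y.
- by exists 0, 0, x.
- by exists n, m, z.
- have [le|/ltnW le] := leqP n m'.
    exists (m' - n + m), n', z'; split=> //.
    by rewrite (iter_opt_add _ Ex) -(iter_opt_add _ Ey) subnK.
  exists m, (n - m' + n'), z; split=> //.
  by rewrite (iter_opt_add _ Ew) -(iter_opt_add _ Ey') subnK.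
Qed.

Hypothesis orb : single_orbit f.

(** A common iterate of [x] and [y] lies in both sets. This rules out two sinks, two rising
    components, two separate families of levels inside one component, and two cycles. *)
Lemma closed_meet (P Q : X -> Prop) x y :
  (forall u v, P u -> f u = Some v -> P v) ->
  (forall u v, Q u -> f u = Some v -> Q v) ->
  P x -> Q y -> exists z, P z /\ Q z.
Proof.
move=> Pf Qf Px Qy; have [m [n [z [Ex Ey]]]] := orbit_merge (proj2 orb x y).
by exists z; split; [apply: iter_opt_closed Ex Px | apply: iter_opt_closed Ey Qy].
Qed.

Lemma sink_unique x y : f x = None -> f y = None -> x = y.
Proof.
move=> fx fy; have [||||z [-> ->]] // := @closed_meet (eq^~ x) (eq^~ y) x y.
  by move=> u v ->; rewrite fx.
by move=> u v ->; rewrite fy.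
Qed.
End Orbit.

(** * Ultimately periodic models *)

(* The finite part [alpha] need not be injective; each column [beta b] is, from
   its second entry on, mapped to a single vertex or to a column by a shift of
   [s - 1] with [s] among 0, 1, 2. *)
Definition periodic_model (X : Type) (f : X -> option X) (A B : finType)
    (alpha : A -> X) (beta : B -> nat -> X) : Prop :=
  [/\ forall x, (exists a, alpha a = x) \/ (exists b j, beta b j = x),
      forall b j b' j', beta b j = beta b' j' -> b = b' /\ j = j',
      forall a b j, alpha a <> beta b j
    & forall b,
      (exists c, forall j, 0 < j -> f (beta b j) = Some c) \/
      (exists b' s, s <= 2 /\
         forall j, 0 < j -> f (beta b j) = Some (beta b' (j + s).-1))].

Lemma radix_inj p r j r' j' :
  r < p -> r' < p -> r + j * p = r' + j' * p -> r = r' /\ j = j'.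
Proof.
move=> lt_r lt_r' E; suff Ej : j = j' by split=> //; move: E; rewrite Ej => /addIn.
have p_gt0 : 0 < p by lia.
have := congr1 (divn^~ p) E.
by rewrite /= !(addnC _ (_ * p)) !divnMDl // !divn_small // !addn0.
Qed.

Lemma nat_presentation_model (X : Type) (f : X -> option X) nu N p :
  single_orbit f -> nat_presentation f nu N p ->
  exists (A B : finType) (alpha : A -> X) (beta : B -> nat -> X),
    periodic_model f alpha beta.
Proof.
move=> orb [p0_gt0 surj /(biper_mul N.+1) [E1 E2 _] /(biper_mul N.+1) [F1 F2 F3]].
(* With a period above [N], a gap of less than [N] is less than one level. *)
have : N < p * N.+1 by nia.
move: (p * N.+1) => {p0_gt0}q in E1 E2 F1 F2 F3 *; move: q => {}p in E1 E2 F1 F2 F3 * => lt_Np.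
have [[x0] _] := orb.
pose Dom n := nu_eq nu n n /\ forall m, m < n -> ~ nu_eq nu m n.
pose g n := odflt x0 (nu n).
have nug n : Dom n -> nu n = Some (g n).
  by rewrite /g => -[[x [-> _]] _].
have Dinj m n : Dom m -> Dom n -> g m = g n -> m = n.
  move=> Dm Dn E; have Emn : nu_eq nu m n by exists (g m); rewrite {2}E !nug.
  have Enm : nu_eq nu n m by exists (g m); rewrite {1}E !nug.
  case: (ltngtP m n) => // lt; first by case: (proj2 Dn _ lt).
  by case: (proj2 Dm _ lt).
have Dsurj x : exists2 n, Dom n & g n = x.
  have ex : exists n, `[< nu n = Some x >].
    by have [n En] := surj x; exists n; apply/asboolP.
  case: (ex_minnP ex) => n /asboolP En nmin; exists n; last by rewrite /g En.
  split; first by exists x.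
  move=> m lt_mn [y [Em]]; rewrite En => -[Ey].
  have : n <= m by apply: nmin; apply/asboolP; rewrite Em Ey.
  by rewrite leqNgt lt_mn.
(* A smaller name of the same vertex is either long, and is pumped together with [n] by clause one,
   or short, and then [n] alone is pumped by clause two. *)
have Dper n : N + N + p <= n -> Dom n <-> Dom (n + p).
  move=> le_n; split=> -[Enn nE]; split.
  - by apply/(E1 n n) => //; lia.
  - move=> m lt_m Em; have [le_m|lt_m'] := leqP (N + p) m.
      apply: (nE (m - p)); first by lia.
      by apply/(E1 (m - p) n); rewrite ?subnK //; lia.
    by apply: (nE m); [lia|apply/(E2 m n) => //; lia].
  - by apply/(E1 n n) => //; lia.
  - move=> m lt_m Em; have [le_m|lt_m'] := leqP N m.
      by apply: (nE (m + p)); [lia|apply/(E1 m n) => //; lia].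
    by apply: (nE m); [lia|apply/(E2 m n) => //; lia].
(* At most one vertex lacks a successor, so [f] is defined on all representatives from some [K]
   on. *)
have [K HK] : exists K, forall n, Dom n -> K <= n -> f (g n) <> None.
  have [[s fs]|nosink] := EM (exists s, f s = None); last first.
    by exists 0 => n _ _ fn; apply: nosink; exists (g n).
  have [k Dk Ek] := Dsurj s; exists k.+1 => n Dn lt_kn fn.
  have E : k = n by apply: Dinj => //; rewrite Ek; apply: sink_unique orb _ _ fs fn.
  by rewrite E ltnn in lt_kn.
have [M [le_M le_K]] : exists M, N + N + p + N <= M /\ K <= M.
  by exists (N + N + p + N + K); split; lia.
have DperM r j : Dom (M + r + j * p) <-> Dom (M + r).
  elim: j => [|j IH]; first by rewrite addn0.
  by rewrite mulSn (addnC p) addnA -Dper ?IH //; lia.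
pose A : finType := {m : 'I_M | `[< Dom m >]}.
pose B : finType := {r : 'I_p | `[< Dom (M + r) >]}.
have DA (a : A) : Dom (nat_of_ord (sval a)) by apply/asboolP/(valP a).
have DB (b : B) j : Dom (M + nat_of_ord (sval b) + j * p).
  by apply/DperM/asboolP/(valP b).
have split_ge n : Dom n -> M <= n -> exists (b : B) j, n = M + nat_of_ord (sval b) + j * p.
  move=> Dn le_n; have lt_r : (n - M) %% p < p by rewrite ltn_mod; lia.
  have En : n = M + (n - M) %% p + (n - M) %/ p * p.
    by rewrite -addnA (addnC (_ %% _)) -divn_eq subnKC.
  have Db : `[< Dom (M + Ordinal lt_r) >].
    by apply/asboolP; rewrite /= -(DperM _ ((n - M) %/ p)) -En.
  by exists (Sub (Ordinal lt_r) Db), ((n - M) %/ p).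
exists A, B, (fun a => g (nat_of_ord (sval a))), (fun b j => g (M + nat_of_ord (sval b) + j * p)); split.
- move=> x; have [n Dn <-] := Dsurj x; have [lt_n|le_n] := ltnP n M.
    left; have Da : `[< Dom (Ordinal lt_n) >] by apply/asboolP.
    by exists (Sub (Ordinal lt_n) Da).
  by right; have [b [j ->]] := split_ge n Dn le_n; exists b, j.
- move=> b j b' j' /Dinj E; have {E} := E (DB b j) (DB b' j').
  rewrite -!addnA => /addnI E.
  have [Er ->] := radix_inj (ltn_ord (sval b)) (ltn_ord (sval b')) E.
  by split=> //; apply/val_inj/ord_inj.
- move=> a b j /Dinj E; have {E} := E (DA a) (DB b j).
  have := ltn_ord (sval a); move: (nat_of_ord _) (nat_of_ord _) => u v; lia.
(* The behaviour of a column is read off at entry 1, one period above the start: a target less than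
   [N] below [m] is then still at least [M], hence in a column. *)
move=> b; have [m Em] : exists m, m = M + nat_of_ord (sval b) + p by eexists.
have Dm : Dom m by have := DB b 1; rewrite mul1n -Em.
case Ef: (f (g m)) => [y|]; last by case: (HK m Dm) => //; lia.
have [n Dn En] := Dsurj y.
have Fmn : nu_edge f nu m n.
  by exists (g m), (g n); rewrite !nug ?En.
have edgeE m' n' : Dom m' -> Dom n' -> nu_edge f nu m' n' -> f (g m') = Some (g n').
  by move=> D D' [x [z []]]; rewrite !nug // => -[->] [->].
(* Otherwise clause two would make [n + p], which represents another vertex, a second successor. *)
have lt_n : n < m + N.
  rewrite ltnNge; apply/negP => le_n.
  have Dnp : Dom (n + p) by apply/(Dper n) => //; lia.
  have /edgeE : nu_edge f nu m (n + p) by apply/(F2 m n).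
  by rewrite Ef => /(_ Dm Dnp)[]; rewrite -En => /Dinj-/(_ Dn Dnp); lia.
have mE j : 0 < j -> M + nat_of_ord (sval b) + j * p = m + j.-1 * p.
  by case: j => // j _; rewrite Em mulSn addnA.
(* If the target is far below, clause three pumps the source alone and all later entries share the
   target [y]. *)
have [le_n|lt_m] := leqP (n + N) m.
  left; exists y => j j_gt0; rewrite -En; apply: edgeE => //.
  rewrite mE //; elim: (j.-1) => [|k IH]; first by rewrite addn0.
  by rewrite mulSn (addnC p) addnA; apply/(F3 (m + k * p) n) => //; lia.
right; have [||b' [s Es]] := split_ge n; [by []|by lia|].
exists b', s; split.
  have lt_b := ltn_ord (sval b); rewrite leqNgt; apply/negP => lt_s.
  suff : 3 * p <= s * p by move: lt_n; rewrite Em Es; lia.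
  by rewrite leq_mul2r lt_s orbT.
move=> j j_gt0; apply: edgeE => //; rewrite mE //.
have -> : M + nat_of_ord (sval b') + (j + s).-1 * p = n + j.-1 * p.
  by rewrite Es -[RHS]addnA -mulnDl; congr (_ + _ * _); lia.
elim: (j.-1) => [|k IH]; first by rewrite !addn0.
rewrite mulSn (addnC p) !addnA; apply/(F1 (m + k * p) (n + k * p)) => //; lia.
Qed.

Lemma fin_bound (T : finType) (P : T -> nat -> Prop) :
  (forall t, exists n, forall m, n <= m -> P t m) ->
  exists n, forall t m, n <= m -> P t m.
Proof.
move=> /choice[g Hg]; exists (\max_t g t) => t m le_m; apply: Hg.
exact: leq_trans (leq_bigmax t) le_m.
Qed.

(** Name [A] by an initial segment and then interleave the columns in blocks of length [p], one
    block per level. A vertex has finitely many names, and a shift by one level is a shift of names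
    by [p]. *)
Lemma model_nat_presentation (X : Type) (f : X -> option X) (A B : finType)
    (alpha : A -> X) (beta : B -> nat -> X) :
  periodic_model f alpha beta -> exists nu N p, nat_presentation f nu N p.
Proof.
case=> cover binj disj class.
(* The successor keeps the period positive when [B] is empty; the residue [#|B|] names nothing. *)
pose a := #|A|; pose p := #|B|.+1.
pose nu m := if m < a then omap alpha (onth (enum A) m)
  else omap (fun b => beta b ((m - a) %/ p)) (onth (enum B) ((m - a) %% p)).
pose enc b j := a + (index b (enum B) + j * p).
have idx_lt b : index b (enum B) < p.
  by rewrite /p ltnS ltnW // cardE index_mem mem_enum.
have nu_lt m : m < a -> exists t, nu m = Some (alpha t).
  move=> lt_m; rewrite /nu lt_m; case E: onth => [t|]; first by exists t.
  by have := onthTE (enum A) m; rewrite E -cardE lt_m.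
have nu_idx t : nu (index t (enum A)) = Some (alpha t).
  rewrite /nu /a cardE index_mem mem_enum onthE (nth_map t) ?index_mem ?mem_enum //.
  by rewrite nth_index ?mem_enum.
have nu_enc b j : nu (enc b j) = Some (beta b j).
  rewrite /nu /enc ltnNge leq_addr /= addKn (addnC (index _ _)) divnMDl // divn_small // addn0.
  rewrite modnMDl modn_small //.
  by rewrite onthE (nth_map b) ?index_mem ?mem_enum // nth_index ?mem_enum.
have nu_split m : a <= m -> (exists b j, m = enc b j) \/ (nu m = None /\ nu (m + p) = None).
  move=> le_m; rewrite /nu !ltnNge le_m (leq_trans le_m (leq_addr p m)) /= -(addnBAC p le_m) modnDr.
  case E: onth => [b|]; last by right.
  left; exists b, ((m - a) %/ p); rewrite /enc.
  suff -> : index b (enum B) = (m - a) %% p by rewrite (addnC (_ %% _)) -divn_eq subnKC.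
  have lt : (m - a) %% p < size (enum B) by rewrite -onthTE E.
  by rewrite -(onth_nth b b _ _ E) index_uniq ?enum_uniq.
have encS b j : enc b j + p = enc b j.+1 by rewrite /enc; lia.
have enc_ge b j : a + j * p <= enc b j by rewrite /enc; lia.
have enc_lt b j : enc b j < a + j.+1 * p by rewrite /enc; have := idx_lt b; lia.
have enc_a b j : a <= enc b j by apply: leq_addr.
have nu_beta b j n : nu n = Some (beta b j) <-> n = enc b j.
  split=> [En|->]; last exact: nu_enc.
  have [/nu_lt[t Et]|/nu_split[[b' [j' E]]|[E _]]] := ltnP n a.
  - by move: En; rewrite Et => -[/disj].
  - by move: En; rewrite E nu_enc => -[/binj[-> ->]].
  - by rewrite E in En.
have bnd x : exists K, forall m, K <= m -> forall n, nu n = Some x -> n < m.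
  have [[t <-]|[b [j <-]]] := cover x; last first.
    by exists (enc b j).+1 => m lt_m n /nu_beta->.
  exists a => m le_m n En; apply: leq_trans le_m; rewrite ltnNge; apply/negP => /nu_split.
  by case=> [[b [j E]]|[E _]]; move: En; rewrite E // nu_enc => -[/esym/disj].
have [K1 HK1] : exists K, forall t m, K <= m -> forall y n, f (alpha t) = Some y -> nu n = Some y -> n < m.
  apply: fin_bound => t; case: (f (alpha t)) => [y|]; last by exists 0.
  by have [K HK] := bnd y; exists K => m /HK H _ n [<-]; apply: H.
have [K2 HK2] : exists K, forall b m, K <= m -> forall y n, f (beta b 0) = Some y -> nu n = Some y -> n < m.
  apply: fin_bound => t; case: (f (beta t 0)) => [y|]; last by exists 0.
  by have [K HK] := bnd y; exists K => m /HK H _ n [<-]; apply: H.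
have [K3 HK3] : exists K, forall b m, K <= m ->
    (exists c, (forall j, 0 < j -> f (beta b j) = Some c) /\ forall n, nu n = Some c -> n < m) \/
    (exists b' s, s <= 2 /\ forall j, 0 < j -> f (beta b j) = Some (beta b' (j + s).-1)).
  apply: fin_bound => b; case: (class b) => [[c Hc]|sh]; last by exists 0 => *; right.
  by have [K HK] := bnd c; exists K => m /HK H; left; exists c.
have [K [le1 le2 le3]] : exists K, [/\ K1 <= K, K2 <= K & K3 <= K].
  by exists (K1 + K2 + K3); split; lia.
have {HK1} HK1 t := HK1 t K le1; have {HK2} HK2 b := HK2 b K le2.
have {HK3} {}class b := HK3 b K le3.
(* [K] bounds the names of all irregular targets: images of [alpha], images of entries 0, and
   constant targets. Along a shift by at most one level two names differ by less than [3 * p]. *)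
have [N EN] : exists N, N = K + a + 3 * p by eexists.
have edgeE m n x : nu m = Some x -> nu_edge f nu m n <-> exists y, f x = Some y /\ nu n = Some y.
  move=> Em; split=> [[x' [y [Ex' En fx]]]|[y [fx En]]]; last by exists x, y.
  by move: Ex'; rewrite Em => -[->]; exists y.
have edgeS m n y x : nu m = Some x -> f x = Some y -> nu_edge f nu m n <-> nu n = Some y.
  by move=> Em fx; rewrite (edgeE _ _ _ Em) fx; split=> [[_ [[<-]]]|H] //; exists y.
have noedge m n : nu m = None -> ~ nu_edge f nu m n by move=> Em [x [y [Ex]]]; rewrite Em in Ex.
(* This makes both sides of clause two false for edges. *)
have up m n : nu_edge f nu m n -> n < m + N.
  have [/nu_lt[t Et]|/nu_split[[b [j Em]]|[/noedge E _ /E//]]] := ltnP m a.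
    by rewrite (edgeE _ _ _ Et) => -[y [fy /(HK1 _ _ _ fy)]]; lia.
  rewrite Em; case: j Em => [|j] Em.
    by rewrite (edgeE _ _ _ (nu_enc _ _)) => -[y [fy /(HK2 _ _ _ fy)]]; lia.
  have [[c [fc Hc]]|[b' [s [le_s Hs]]]] := class b.
    by rewrite (edgeS _ _ _ _ (nu_enc _ _) (fc _ (ltn0Sn _))) => /Hc; lia.
  rewrite (edgeS _ _ _ _ (nu_enc _ _) (Hs _ (ltn0Sn _))) => /nu_beta->.
  have := enc_lt b' (j.+1 + s).-1; have := enc_ge b j.+1; nia.
have low m : N <= m -> (nu m = None /\ nu (m + p) = None) \/ exists b j, m = enc b j.+1.
  move=> le_m; have [|[b [[|j] E]]|E] := @nu_split m _; [by lia| |by right; exists b, j|by left].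
  by have := enc_lt b 0; lia.
exists nu, N, p; split=> //.
- by move=> x; have [[t <-]|[b [j <-]]] := cover x;
    [exists (index t (enum A)) | exists (enc b j)].
- have eqE m n : a <= n \/ a <= m -> nu_eq nu m n <-> m = n /\ nu n <> None.
    have half m' n' : a <= n' -> nu_eq nu m' n' -> m' = n'.
      move=> le_n [x [Em En]]; have [[b [j E]]|[E _]] := nu_split _ le_n; last by rewrite E in En.
      by move: En Em; rewrite E nu_enc => -[<-] /nu_beta.
    move=> le; split=> [[x [Em En]]|[-> ]]; last by case E: (nu n) => [x|] // _; exists x.
    split; last by rewrite En.
    case: le => le; first by apply: half le _; exists x.
    by apply/esym/(half _ _ le); exists x.
  have nuS m : a <= m -> nu (m + p) <> None <-> nu m <> None.
    by move=> /nu_split[[b [j ->]]|[-> ->] //]; rewrite encS !nu_enc.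
  split=> m n.
  + move=> le_m le_n; rewrite !eqE; try lia.
    by rewrite nuS; [split=> -[E ?]; split=> //; lia | lia].
  + by move=> le_n; rewrite !eqE; try lia; split=> -[E]; lia.
  + by move=> le_n; rewrite !eqE; try lia; split=> -[E]; lia.
split=> m n.
- move=> le_m le_n; have [[E1 E2]|[b [j ->]]] := low m le_m.
    by split=> H; [case: (noedge _ _ E1 H) | case: (noedge _ _ E2 H)].
  rewrite encS; have [[c [fc Hc]]|[b' [s [le_s Hs]]]] := class b.
    rewrite !(edgeS _ _ _ _ (nu_enc _ _) (fc _ (ltn0Sn _))).
    by split=> /Hc; lia.
  rewrite !(edgeS _ _ _ _ (nu_enc _ _) (Hs _ (ltn0Sn _))) !nu_beta.
  rewrite (_ : (j.+2 + s).-1 = (j.+1 + s).-1.+1) // -encS.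
  by split=> [->//|/addIn].
- by move=> le_n; split=> /up; lia.
- move=> le_n; have [|[E1 E2]|[b [j Em]]] := low m; first by lia.
    by split=> H; [case: (noedge _ _ E1 H) | case: (noedge _ _ E2 H)].
  rewrite Em encS; have [[c [fc Hc]]|[b' [s [le_s Hs]]]] := class b.
    by rewrite !(edgeS _ _ _ _ (nu_enc _ _) (fc _ (ltn0Sn _))).
  rewrite !(edgeS _ _ _ _ (nu_enc _ _) (Hs _ (ltn0Sn _))) !nu_beta.
  split=> En; have := enc_lt b j.+1; move: le_n; rewrite En Em.
    have := enc_ge b' (j.+1 + s).-1; nia.
  have := enc_ge b' (j.+2 + s).-1; nia.
Qed.

(** * Glued graphs *)

Lemma geqv_invariant (g : ggraph) (Y : Type) (h : gV g -> Y) :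
  (forall u v, gG u v -> h u = h v) -> forall u v, geqv u v -> h u = h v.
Proof. by move=> hG u v; elim=> // {u v} u v w _ -> _ ->. Qed.

Lemma sigrel_invariant (k : nat) (P : 'I_k -> ggraph)
    (R : forall i, gV (P i) -> gV (P i) -> Prop) (Y : Type)
    (h : {i : 'I_k & gV (P i)} -> Y) :
  (forall i u v, R i u v -> h (existT _ i u) = h (existT _ i v)) ->
  forall s t, sigrel R s t -> h s = h t.
Proof. by move=> hR s t [i u v /hR]. Qed.

Lemma qedge_geqv (g : ggraph) (u u' v v' : gV g) :
  geqv u u' -> geqv v v' -> qedge u' v' -> qedge u v.
Proof.
move=> uu vv [x [y [ux [vy E]]]]; exists x, y.
by split; [apply: rst_trans uu ux | split=> //; apply: rst_trans vv vy].
Qed.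

Section Attach.
Variables (K : ggraph) (k : nat) (P : 'I_k -> ggraph).
Variables (p : forall i, gV (P i)) (a : 'I_k -> gV K).
Let G := multi_attach K P p a.

Lemma geqv_inl (u v : gV K) : geqv u v -> @geqv G (inl u) (inl v).
Proof.
elim=> {u v} [u v uv|u|u v _|u v w _ H1 _ H2].
- exact: rst_step.
- exact: rst_refl.
- exact: rst_sym.
- exact: rst_trans H1 H2.
Qed.

Lemma geqv_inr i (u v : gV (P i)) :
  geqv u v -> @geqv G (inr (existT _ i u)) (inr (existT _ i v)).
Proof.
elim=> {u v} [u v uv|u|u v _|u v w _ H1 _ H2].
- by apply: rst_step; apply: sigrel_in.
- exact: rst_refl.
- exact: rst_sym.
- exact: rst_trans H1 H2.
Qed.

Lemma geqv_glue i : @geqv G (inr (existT _ i (p i))) (inl (a i)).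
Proof. by apply: rst_sym; apply: rst_step. Qed.

Lemma qedge_inl (u v : gV K) : qedge u v -> @qedge G (inl u) (inl v).
Proof. by move=> [u' [v' [/geqv_inl U [/geqv_inl V E]]]]; exists (inl u'), (inl v'). Qed.

Lemma qedge_inr i (u v : gV (P i)) :
  gE u v -> @qedge G (inr (existT _ i u)) (inr (existT _ i v)).
Proof.
move=> E; do 2 eexists; split; first exact: rst_refl.
by split; [exact: rst_refl | apply: sigrel_in].
Qed.

(* Collapsing every attached piece onto its attaching vertex retracts the glued
   graph onto [K]. *)
Lemma geqv_inlE (u v : gV K) : @geqv G (inl u) (inl v) -> geqv u v.
Proof.
pose h (x : gV G) := match x with
  | inl w => @geqv K w
  | inr (existT i _) => @geqv K (a i) end.
have cls (x y : gV K) : geqv x y -> @geqv K x = @geqv K y.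
  move=> xy; apply/funext => z; apply/propext; split; last exact: rst_trans.
  by apply: rst_trans; apply: rst_sym.
have hG x y : @gG G x y -> h x = h y.
  case: x y => [x|[i x]] [y|[j y]] //=.
  - by move=> xy; apply/cls/rst_step.
  - by move=> [-> _].
  - by apply: (sigrel_invariant (h := fun t => h (inr t))).
move=> /(geqv_invariant hG) /= E.
by rewrite E; apply: rst_refl.
Qed.

End Attach.

(** The vertex [tt0] of a copy [j.+1] is [tt1] of copy [j]. For a path the descent stops there, as
    [tt1] is not [tt0]; for a star it continues to the base. *)
Lemma S_rep (Q : template) j (x : tT Q) :
  @geqv (S_g Q) (j, x) (S_base Q) \/
  exists j' x', x' != tt0 Q /\ @geqv (S_g Q) (j, x) (j', x').
Proof.
elim: j x => [|j IH] x; (have [->|nx] := eqVneq x (tt0 Q); last first).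
- by right; exists 0, x; split=> //; apply: rst_refl.
- by left; apply: rst_refl.
- by right; exists j.+1, x; split=> //; apply: rst_refl.
have E : @geqv (S_g Q) (j.+1, tt0 Q) (j, tt1 Q) by apply/rst_sym/rst_step.
have [H|[j' [x' [nx H]]]] := IH (tt1 Q); first by left; apply: rst_trans E H.
by right; exists j', x'; split=> //; apply: rst_trans E H.
Qed.

Lemma star_geqv (Q : template) j : tt1 Q = tt0 Q ->
  @geqv (S_g Q) (j, tt0 Q) (S_base Q).
Proof.
move=> E; elim: j => [|j]; first exact: rst_refl.
by apply: rst_trans; apply/rst_sym/rst_step; rewrite /= E.
Qed.

Section AttachS.
Variables (K : ggraph) (k : nat) (Q : 'I_k -> template) (a : 'I_k -> gV K).
Let G := multi_attach K (fun i => S_g (Q i)) (fun i => S_base (Q i)) a.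

Definition S_vertex (i : 'I_k) (j : nat) (x : tT (Q i)) : gV G :=
  inr (existT (fun i => gV (S_g (Q i))) i (j, x)).

(** The normal form of [S_rep] as a function, which makes it an invariant of the identification.
    [None] stands for the vertices of [K] and everything glued to them. *)
Definition S_column (u : gV G) : option {i : 'I_k & (nat * tT (Q i))%type} :=
  match u with
  | inl _ => None
  | inr (existT i (j, x)) =>
      if x != tt0 (Q i) then Some (existT _ i (j, x))
      else if (tt1 (Q i) == tt0 (Q i)) || (j == 0) then None
      else Some (existT _ i (j.-1, tt1 (Q i)))
  end.

Lemma S_column_geqv u v : @geqv G u v -> S_column u = S_column v.
Proof.
apply: geqv_invariant => -[x|[i x]] [y|[i' y]] //=.
  by move=> [_ ->]; rewrite /S_base eqxx orbT.
apply: (sigrel_invariant (P := fun i => S_g (Q i)) (h := fun t => S_column (inr t))).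
move=> {i i' x y} i [j x] [j' y] /= [-> [-> ->]].
by rewrite eqxx /= orbF; case: eqP => //= ->; rewrite eqxx.
Qed.

Lemma S_vertex_inl i j x u : x != tt0 (Q i) -> ~ @geqv G (S_vertex j x) (inl u).
Proof. by move=> nx /S_column_geqv /=; rewrite nx. Qed.

Lemma S_vertex_inj i j x i' j' x' : x != tt0 (Q i) -> x' != tt0 (Q i') ->
  @geqv G (S_vertex j x) (S_vertex j' x') ->
  existT (fun i => tT (Q i)) i x = existT _ i' x' /\ j = j'.
Proof.
move=> nx nx' /S_column_geqv /=; rewrite nx nx' => E.
have {}E := Some_inj E; split.
  exact: (congr1 (fun t : {i : 'I_k & (nat * tT (Q i))%type} =>
    existT (fun i => tT (Q i)) (projT1 t) (projT2 t).2) E).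
exact: (congr1 (fun t : {i : 'I_k & (nat * tT (Q i))%type} => (projT2 t).1) E).
Qed.
End AttachS.

Lemma inward_step (T : eqType) (eta : T -> option T) r x :
  inward_rooted eta r -> x != r -> exists y, eta x = Some y.
Proof.
move=> [_ /(_ x)[[|n]]]; first by move=> [->]; rewrite eqxx.
by rewrite iter_optS; case: (eta x) => // y _ _; exists y.
Qed.

(** As [tt0] is not the root [tt1], it has an out-edge. Being a leaf, it has no other neighbour, so
    a predecessor would form a 2-cycle with it and [tt1] would be out of reach. *)
Lemma outward_avoid (O : template) x y : outward_path_template O ->
  teta x = Some y -> y != tt0 O.
Proof.
move=> [/eqP n01 [inw /card_le1_eqP leaf]] Ex; apply/eqP => Ey; subst y.
have [z Ez] := inward_step inw n01.
have Exz : x = z by apply: leaf; rewrite inE ?Ex ?Ez eqxx ?orbT.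
subst z; case: inw => E1 /(_ (tt0 O))[n En].
have : tt1 O = x \/ tt1 O = tt0 O.
  apply: (@iter_opt_closed _ _ (fun u => u = x \/ u = tt0 O) _ _ _ _ En); last by right.
  move=> u v [->|->]; first by rewrite Ex => -[<-]; right.
  by rewrite Ez => -[<-]; left.
by case=> E; move: E1; rewrite E ?Ex ?Ez.
Qed.

(** * The three shapes have ultimately periodic models *)

(** Counterpart of [periodic_model] for the graph before decoration; constant targets are absent, as
    they come from shallow stars only. *)
Definition graph_model (G : ggraph) (A B : finType) (alpha : A -> gV G)
    (beta : B -> nat -> gV G) : Prop :=
  [/\ forall u, (exists a, geqv u (alpha a)) \/ (exists b j, geqv u (beta b j)),
      forall b j b' j', geqv (beta b j) (beta b' j') -> b = b' /\ j = j',
      forall a b j, ~ geqv (beta b j) (alpha a)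
    & forall b, exists b' s, s <= 2 /\
        forall j, 0 < j -> qedge (beta b j) (beta b' (j + s).-1)].

Lemma finite_graph_model (G : ggraph) (A : finType) (alpha : A -> gV G) :
  (forall u, exists a, alpha a = u) ->
  graph_model alpha (fun b : void => match b return nat -> gV G with end).
Proof.
move=> surj; split; try by case.
- by move=> u; left; have [a <-] := surj u; exists a; apply: rst_refl.
- by move=> a [].
Qed.

(** The columns are the template vertices other than [tt0]. Edges stay in their copy ([s = 1]),
    except from [tt1], which is [tt0] of the next copy and so moves up one level ([s = 2]). *)
Lemma outward_graph_model (R : rtree) (O : template) : outward_path_template O ->
  graph_model
    (G := @multi_attach (tree_g R) 1 (fun _ => S_g O) (fun _ => S_base O) (fun _ => rroot R))
    inl (fun (b : {x : tT O | x != tt0 O}) j => inr (existT _ ord0 (j, sval b))).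
Proof.
move=> out; pose Q (i : 'I_1) := O; have [/eqP n01 [inw _]] := out; split.
- move=> [u|[i [j x]]]; first by left; exists u; apply: rst_refl.
  rewrite (ord1 i); have [H|[j' [x' [nx H]]]] := S_rep j x.
    left; exists (rroot R); apply: rst_trans; last exact: (geqv_glue _ _ ord0).
    exact: (@geqv_inr (tree_g R) 1 (fun _ => S_g O) (fun _ => S_base O) (fun _ => rroot R) ord0 _ _ H).
  right; exists (exist _ x' nx), j'.
  exact: (@geqv_inr (tree_g R) 1 (fun _ => S_g O) (fun _ => S_base O) (fun _ => rroot R) ord0 _ _ H).
- move=> [x nx] j [x' nx'] j' /(@S_vertex_inj (tree_g R) 1 Q (fun _ => rroot R)) H.
  have [E ->] := H nx nx'; split=> //; apply: val_inj => /=.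
  by apply: (congr1 (fun t : {i : 'I_1 & tT (Q i)} => (projT2 t : tT O)) E).
- by move=> a [x nx] j /(@S_vertex_inl (tree_g R) 1 Q (fun _ => rroot R)); apply.
move=> [x nx]; have [Ex|nx1] := eqVneq x (tt1 O).
  have [z Ez] := inward_step inw n01.
  exists (exist _ z (outward_avoid out Ez)), 2; split=> // j _.
  apply: (@qedge_geqv _ _ (@S_vertex (tree_g R) 1 Q (fun _ => rroot R) ord0 j.+1 (tt0 O)) _ _ _ (rst_refl _ _ _)).
    apply: (@geqv_inr (tree_g R) 1 (fun _ => S_g O) (fun _ => S_base O) (fun _ => rroot R) ord0).
    by apply: rst_step; rewrite /= Ex.
  apply: (@qedge_inr (tree_g R) 1 (fun _ => S_g O) (fun _ => S_base O) (fun _ => rroot R) ord0).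
  by split=> //=; rewrite addn2.
have [y Ey] := inward_step inw nx1.
exists (exist _ y (outward_avoid out Ey)), 1; split=> // j _.
apply: (@qedge_inr (tree_g R) 1 (fun _ => S_g O) (fun _ => S_base O) (fun _ => rroot R) ord0).
by split=> //=; rewrite addn1.
Qed.

(** Edges of a decoration stay in their copy unless they end in [tt0]. That vertex is the attaching
    point for a star, a constant target, and [tt1] of the preceding copy for a path, so [s = 0];
    copy 0 is the exception that [periodic_model] allows. *)
Lemma decorated_model (X : Type) (f : X -> option X) (G : ggraph) (A0 B0 : finType)
    (alpha : A0 -> gV G) (beta : B0 -> nat -> gV G) :
  graph_model alpha beta -> decorations_iso f G ->
  exists (A B : finType) (alpha : A -> X) (beta : B -> nat -> X),
    periodic_model f alpha beta.
Proof.
move=> [cover0 inj0 disj0 class0] [m [Q [b [inw [psi [surj [psieq psiedge]]]]]]].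
pose SV i j x := @S_vertex G m Q b i j x.
pose B : finType := (B0 + {i : 'I_m & {x : tT (Q i) | x != tt0 (Q i)}})%type.
pose bet (c : B) j := match c with
  | inl c0 => psi (inl (beta c0 j))
  | inr (existT i x) => psi (SV i j (sval x)) end.
have SVbase i : psi (SV i 0 (tt0 (Q i))) = psi (inl (b i)).
  by apply/psieq; apply: geqv_glue.
have SVeq i u v : @geqv (S_g (Q i)) u v -> psi (SV i u.1 u.2) = psi (SV i v.1 v.2).
  case: u v => j x [j' x'] H; apply/psieq.
  exact: (@geqv_inr G m (fun i => S_g (Q i)) (fun i => S_base (Q i)) b i _ _ H).
have SVedge i j x y : teta x = Some y -> f (psi (SV i j x)) = Some (psi (SV i j y)).
  move=> Ex; apply/psiedge.
  by apply: (@qedge_inr G m (fun i => S_g (Q i)) (fun i => S_base (Q i)) b i).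
have packE (t t' : {i : 'I_m & tT (Q i)})
    (n : projT2 t != tt0 (Q (projT1 t))) (n' : projT2 t' != tt0 (Q (projT1 t'))) : t = t' ->
    existT (fun i => {x : tT (Q i) | x != tt0 (Q i)}) (projT1 t) (exist _ (projT2 t) n) =
    existT _ (projT1 t') (exist _ (projT2 t') n').
  by move=> E; subst t'; rewrite (bool_irrelevance n n').
exists A0, B, (fun a => psi (inl (alpha a))), bet.
have inlE u v : psi (inl u) = psi (inl v) <-> geqv u v.
  by rewrite psieq; split; [apply: geqv_inlE | apply: geqv_inl].
have cover_inl u : (exists a, psi (inl (alpha a)) = psi (inl u)) \/
    exists c j, bet c j = psi (inl u).
  have [[a /inlE E]|[c [j /inlE E]]] := cover0 u; first by left; exists a.
  by right; exists (inl c), j.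
split.
- move=> x; have [[u|[i [j y]]] <-] := surj x; first exact: cover_inl.
  have [/SVeq E|[j' [y' [ny /SVeq E]]]] := S_rep j y.
    by rewrite [psi _]E SVbase; apply: cover_inl.
  by right; rewrite [psi _]E; exists (inr (existT _ i (exist _ y' ny))), j'.
- move=> [c|[i [x nx]]] j [c'|[i' [x' nx']]] j' /=.
  + by move=> /inlE/inj0[-> ->].
  + by move=> /esym/psieq/S_vertex_inl; case.
  + by move=> /psieq/S_vertex_inl; case.
  move=> /psieq/S_vertex_inj-/(_ nx nx')[E ->]; split=> //; congr inr.
  exact: (packE (existT _ i x) (existT _ i' x') nx nx' E).
- move=> a [c|[i [x nx]]] j /=; first by move=> /esym/inlE/disj0.
  by move=> /esym/psieq/S_vertex_inl; case.
move=> [c|[i [x nx]]] /=.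
  have [c' [s [le_s H]]] := class0 c; right; exists (inl c'), s; split=> // j /H E.
  by apply/psiedge; apply: qedge_inl.
have [inwi _] := inw i; have [y Ey] := inward_step inwi nx.
have [Eyt|ny] := eqVneq y (tt0 (Q i)); last first.
  right; exists (inr (existT _ i (exist _ y ny))), 1; split=> // j _.
  by rewrite addn1 /=; apply: SVedge.
have [E1|n1] := eqVneq (tt1 (Q i)) (tt0 (Q i)).
  left; exists (psi (inl (b i))) => j _; rewrite (SVedge _ _ _ _ Ey) Eyt.
  by have /= -> := SVeq _ _ _ (star_geqv j E1); rewrite SVbase.
right; exists (inr (existT _ i (exist _ (tt1 (Q i)) n1))), 0; split=> // -[//|j] _.
rewrite (SVedge _ _ _ _ Ey) Eyt addn0 /=; congr Some.
by apply/esym; apply: (SVeq i (j, _) (j.+1, _)); apply: rst_step.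
Qed.

Lemma shape_model (X : Type) (f : X -> option X) :
  shape1 f \/ shape2 f \/ shape3 f ->
  exists (A B : finType) (alpha : A -> X) (beta : B -> nat -> X),
    periodic_model f alpha beta.
Proof.
case=> [[n [k [P [a [_ D]]]]]|[[R [O [_ [out D]]]]|[R [_ D]]]].
- pose T : finType := ('I_n.+1 + {i : 'I_k & rT (P i)})%type.
  by apply: (@decorated_model _ _ _ T _ _ _ (finite_graph_model _) D) => u; exists u.
- exact: decorated_model (outward_graph_model R out) D.
- by apply: (@decorated_model _ _ _ (rT R) _ _ _ (finite_graph_model _) D) => u; exists u.
Qed.

(** * Recognising glued graphs *)

Definition reflects (X : Type) (g : ggraph) (psi : gV g -> X) : Prop :=
  forall u v, psi u = psi v <-> geqv u v.

Lemma discrete_reflects (X : Type) (g : ggraph) (psi : gV g -> X) :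
  (forall u v : gV g, ~ gG u v) -> (forall u v, psi u = psi v -> u = v) -> reflects psi.
Proof.
move=> noG inj u v; split=> [/inj->|]; first exact: rst_refl.
by apply: geqv_invariant => x y /noG.
Qed.

Definition attach_map (X : Type) (K : ggraph) (k : nat) (P : 'I_k -> ggraph)
    (p : forall i, gV (P i)) (a : 'I_k -> gV K) (psi : gV K -> X)
    (sigma : forall i, gV (P i) -> X) (x : gV (multi_attach K P p a)) : X :=
  match x with inl u => psi u | inr (existT i u) => sigma i u end.

(** It suffices that the image of a piece meets the image of [K], or of another piece, only in the
    class of its own base: each such coincidence is then forced by the gluing. *)
Lemma attach_reflects (X : Type) (K : ggraph) (k : nat) (P : 'I_k -> ggraph)
    (p : forall i, gV (P i)) (a : 'I_k -> gV K) (psi : gV K -> X)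
    (sigma : forall i, gV (P i) -> X) :
  reflects psi -> (forall i, reflects (sigma i)) ->
  (forall i, sigma i (p i) = psi (a i)) ->
  (forall i u v, sigma i u = psi v -> geqv u (p i)) ->
  (forall i i' u v, sigma i u = sigma i' v -> i = i' \/ geqv u (p i)) ->
  reflects (@attach_map X K k P p a psi sigma).
Proof.
move=> reflK reflP glue cross1 cross2 u v; split; last first.
  apply: geqv_invariant => {u v} -[u|[i u]] [v|[i' v]] //=.
  - by move=> uv; apply/reflK/rst_step.
  - by move=> [-> ->]; rewrite glue.
  - apply: (sigrel_invariant (h := fun t => attach_map (p := p) (a := a) psi sigma (inr t))) => i0 x y xy /=.
    by apply/reflP/rst_step.
have base i w : geqv w (p i) ->
    @geqv (multi_attach K P p a) (inr (existT _ i w)) (inl (a i)).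
  by move=> H; apply: rst_trans (geqv_glue _ _ i); apply: geqv_inr.
have mixed i w z : sigma i w = psi z ->
    @geqv (multi_attach K P p a) (inr (existT _ i w)) (inl z).
  move=> E; have wp := cross1 _ _ _ E; apply: rst_trans (base _ _ wp) _.
  by apply/geqv_inl/reflK; rewrite -glue -E; apply/esym/reflP.
case: u v => [u|[i u]] [v|[i' v]] /=.
- by move=> /reflK/geqv_inl.
- by move=> /esym/mixed; apply: rst_sym.
- exact: mixed.
move=> E; have [Ei|up] := cross2 _ _ _ _ E.
  by subst i'; apply: geqv_inr; apply/reflP.
have Eu : sigma i u = psi (a i) by rewrite -glue; apply/reflP.
apply: rst_trans (mixed _ _ _ Eu) _; apply: rst_sym; apply: mixed.
by rewrite -E.
Qed.

Lemma S_reflects (X : Type) (Q : template) (sigma : nat -> tT Q -> X) :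
  (forall j, sigma j (tt1 Q) = sigma j.+1 (tt0 Q)) ->
  (forall j x j' x', x != tt0 Q -> x' != tt0 Q -> sigma j x = sigma j' x' ->
     x = x' /\ j = j') ->
  (forall j x, x != tt0 Q -> sigma j x <> sigma 0 (tt0 Q)) ->
  reflects (g := S_g Q) (fun u => sigma u.1 u.2).
Proof.
move=> glue inj nbase.
have resp (u v : gV (S_g Q)) : geqv u v -> sigma u.1 u.2 = sigma v.1 v.2.
  apply: (@geqv_invariant (S_g Q) _ (fun u => sigma u.1 u.2)) => -[j x] [j' y] /=.
  by move=> [-> [-> ->]].
move=> u v; split; last exact: resp.
case: u v => [j x] [j' y] /= E.
have [U|[k [z [nz U]]]] := S_rep j x; have [V|[k' [z' [nz' V]]]] := S_rep j' y;
  have /= EU := resp _ _ U; have /= EV := resp _ _ V; rewrite EU EV in E.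
- exact: rst_trans U (rst_sym _ _ _ _ V).
- by case: (nbase _ _ nz' (esym E)).
- by case: (nbase _ _ nz E).
have [Ez Ek] := inj _ _ _ _ nz nz' E; subst z' k'.
exact: rst_trans U (rst_sym _ _ _ _ V).
Qed.

Lemma attach_S_reflects (X : Type) (K : ggraph) (k : nat) (Q : 'I_k -> template)
    (a : 'I_k -> gV K) (psi : gV K -> X) (sigma : forall i, nat -> tT (Q i) -> X) :
  reflects psi ->
  (forall i, sigma i 0 (tt0 (Q i)) = psi (a i)) ->
  (forall i j, sigma i j (tt1 (Q i)) = sigma i j.+1 (tt0 (Q i))) ->
  (forall i j x i' j' x', x != tt0 (Q i) -> x' != tt0 (Q i') ->
     sigma i j x = sigma i' j' x' -> i = i') ->
  (forall i j x j' x', x != tt0 (Q i) -> x' != tt0 (Q i) ->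
     sigma i j x = sigma i j' x' -> x = x' /\ j = j') ->
  (forall i j x u, x != tt0 (Q i) -> sigma i j x <> psi u) ->
  reflects (attach_map (P := fun i => S_g (Q i)) (p := fun i => S_base (Q i)) (a := a)
    psi (fun i u => sigma i u.1 u.2)).
Proof.
move=> reflK base glue inj1 inj2 disj.
have reflS i : reflects (g := S_g (Q i)) (fun u => sigma i u.1 u.2).
  apply: S_reflects => [j|j x j' x'|j x nx]; [exact: glue|exact: inj2|].
  by rewrite base; apply: disj.
have cross i u v : sigma i u.1 u.2 = psi v -> @geqv (S_g (Q i)) u (S_base (Q i)).
  case: u => j x /= E; have [//|[j' [x' [nx U]]]] := S_rep j x.
  by have /reflS /= E' := U; case: (disj _ j' _ v nx); rewrite -E' E.
apply: attach_reflects => // i i' [j x] [j' x'] /= E.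
have [U|[k1 [x1 [nx1 U]]]] := S_rep j x; first by right.
have /reflS /= EU := U.
have [V|[k2 [x2 [nx2 V]]]] := S_rep j' x'; have /reflS /= EV := V.
  by right; apply: (cross i (j, x) (a i')); rewrite /= E EV base.
by left; apply: (inj1 _ k1 x1 _ k2 x2) => //; rewrite -EU -EV.
Qed.

Lemma graph_iso_of_lift (X : Type) (f : X -> option X) (g : ggraph) (psi : gV g -> X) :
  reflects psi -> (forall x, exists u, psi u = x) ->
  (forall u v, gE u v -> f (psi u) = Some (psi v)) ->
  (forall x y, f x = Some y -> exists u v, [/\ psi u = x, psi v = y & gE u v]) ->
  graph_iso f g.
Proof.
move=> refl surj edge lift; exists psi; split=> //; split=> // u v.
split=> [/lift[u' [v' [/esym/refl U /esym/refl V E]]]|[u' [v' [/refl-> [/refl-> /edge//]]]]].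
by exists u', v'.
Qed.

(** Every out-edge of [f] must be lifted. In the image of [psi] this is assumed; elsewhere the
    vertex is not [tt0], so its out-edge is already in the inward template. *)
Lemma decorations_iso_intro (X : Type) (f : X -> option X) (G : ggraph)
    (psi : gV G -> X) (I : finType) (Q : I -> template)
    (sigma : forall i, nat -> tT (Q i) -> X) :
  reflects psi ->
  (forall u v, gE u v -> f (psi u) = Some (psi v)) ->
  (forall u y, f (psi u) = Some y ->
     exists u' v', [/\ psi u' = psi u, psi v' = y & gE u' v']) ->
  (forall i, inward_template (Q i)) ->
  (forall i, exists u, sigma i 0 (tt0 (Q i)) = psi u) ->
  (forall i j, sigma i j (tt1 (Q i)) = sigma i j.+1 (tt0 (Q i))) ->
  (forall i j x y, teta x = Some y -> f (sigma i j x) = Some (sigma i j y)) ->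
  (forall i j x i' j' x', x != tt0 (Q i) -> x' != tt0 (Q i') ->
     sigma i j x = sigma i' j' x' -> i = i') ->
  (forall i j x j' x', x != tt0 (Q i) -> x' != tt0 (Q i) ->
     sigma i j x = sigma i j' x' -> x = x' /\ j = j') ->
  (forall i j x u, x != tt0 (Q i) -> sigma i j x <> psi u) ->
  (forall x, (exists u, psi u = x) \/
     (exists i j t, t != tt0 (Q i) /\ sigma i j t = x)) ->
  decorations_iso f G.
Proof.
move=> refl edge lift inw /choice[b base] glue sedge inj1 inj2 disj cover.
pose e : 'I_#|I| -> I := enum_val.
exists #|I|, (fun k => Q (e k)), (fun k => b (e k)); split=> //.
have reflA := @attach_S_reflects X G #|I| (fun k => Q (e k)) (fun k => b (e k)) psi
  (fun k => sigma (e k)) refl (fun k => base (e k)) (fun k => glue (e k)).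
have cov x : (exists u, psi u = x) \/
    (exists k j t, t != tt0 (Q (e k)) /\ sigma (e k) j t = x).
  have [?|[i [j [t H]]]] := cover x; [by left|right].
  rewrite -(enum_rankK i) in t H; by exists (enum_rank i), j, t.
apply: graph_iso_of_lift.
- apply: reflA => [k j x k' j' x' nx nx' /inj1 E|k j x j' x'|k j x u].
  + by apply: enum_val_inj; apply: E.
  + exact: inj2.
  + exact: disj.
- move=> x; have [[u <-]|[k [j [t [_ <-]]]]] := cov x; first by exists (inl u).
  by exists (inr (existT _ k (j, t))).
- move=> [u|[k u]] [v|[k' v]] //=; first exact: edge.
  move=> H; pose g (t : {k : 'I_#|I| & gV (S_g (Q (e k)))}) :=
    sigma (e (projT1 t)) (projT2 t).1 (projT2 t).2.
  rewrite -/(g (existT _ k u)) -/(g (existT _ k' v)).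
  case: H => {k k' u v} k [j x] [j' y] /= [<- Exy]; exact: sedge.
move=> x y fxy; have [[u Eu]|[k [j [t [nt Et]]]]] := cov x.
  have [|u' [v' [Eu' Ev' E]]] := lift u y; first by rewrite Eu.
  by exists (inl u'), (inl v'); split=> //; rewrite /= Eu'.
have [z Ez] := inward_step (proj1 (inw (e k))) nt.
exists (inr (existT _ k (j, t))), (inr (existT _ k (j, z))); split=> //=.
by have := sedge _ j _ _ Ez; rewrite Et fxy => -[].
Qed.

(** * Normal forms *)

(* [root] selects one column in each component of the column map [W]; [d r] is the
   number of inward periodic paths carried by the component of a root [r], and it is
   0 exactly for the component of the outward path. *)
Record normal_form (X : Type) (f : X -> option X) (C B : finType) (kappa : C -> X)
    (gamma : B -> nat -> X) (W root : B -> B) (d : B -> nat) (st : pred B) : Prop := {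
  nf_kinj : injective kappa;
  nf_ginj : forall b j b' j', gamma b j = gamma b' j' -> b = b' /\ j = j';
  nf_disj : forall c b j, kappa c <> gamma b j;
  nf_cover : forall x, (exists c, kappa c = x) \/ (exists b j, gamma b j = x);
  nf_rootW : forall b, root (W b) = root b;
  nf_rootK : forall b, root (root b) = root b;
  nf_reach : forall b, exists n, iter n W b = root b;
  nf_step : forall b j, b <> root b -> f (gamma b j) = Some (gamma (W b) j);
  nf_root : forall r, root r = r ->
    if st r then d r = 1 /\ exists c, forall j, f (gamma r j) = Some (kappa c)
    else if 0 < d r then
      (forall j, f (gamma r (d r + j)) = Some (gamma (W r) j)) /\
      (forall j, j < d r -> exists c, f (gamma r j) = Some (kappa c))
    else forall j, f (gamma r j) = Some (gamma (W r) j.+1);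
  nf_core : forall c y, f (kappa c) = Some y ->
    (exists c', y = kappa c') \/ exists r, [/\ root r = r, d r = 0 & y = gamma (W r) 0];
  nf_exit : forall r, root r = r -> d r = 0 ->
    exists c0, f (kappa c0) = Some (gamma (W r) 0) /\
      forall c, f (kappa c) = Some (gamma (W r) 0) -> c = c0;
  nf_up_unique : forall r r', root r = r -> root r' = r' -> d r = 0 -> d r' = 0 -> r = r' }.

Section NormalForm.
Variables (X : Type) (f : X -> option X) (C B : finType) (kappa : C -> X)
  (gamma : B -> nat -> X) (W root : B -> B) (d : B -> nat) (st : pred B).
Hypothesis nf : normal_form f kappa gamma W root d st.
Hypothesis orb : single_orbit f.

Notation comp r := {b : B | root b == r}.

Lemma insub_comp r b : root b = r -> exists u : comp r, insub b = Some u /\ sval u = b.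
Proof. by move=> /eqP E; exists (exist _ b E); rewrite (insubT (fun b => root b == r) E). Qed.

Lemma comp_root r (b : comp r) : root (sval b) = r.
Proof. exact/eqP/(valP b). Qed.

(** [None] is the target of the root column. For a path, the target from root level [d r + j] lies
    in column [W r] at level [j], hence the choice of [tt1]; for a star it is one vertex, so [tt1]
    is [tt0]. *)
Definition column_template (r : B) : template :=
  @Template (option (comp r))
    (fun o => if o is Some b then
       if sval b == r then Some None else Some (insub (W (sval b)))
     else None)
    None (if st r then None else insub (W r)).

Lemma column_inward r : inward_template (column_template r).
Proof.
split; first split=> //.
  move=> [b|]; last by exists 0.
  have [n] := nf_reach nf (sval b); rewrite comp_root.
  elim: n b => [|n IH] b; first by move=> /= E; exists 1; rewrite /iter_opt /= E eqxx.
  rewrite iterSr => E; have [Eb|nb] := eqVneq (sval b) r.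
    by exists 1; rewrite /iter_opt /= Eb eqxx.
  have [|u [Eu Wu]] := @insub_comp r (W (sval b)); first by rewrite (nf_rootW nf) comp_root.
  have [|m Em] := IH u; first by rewrite Wu.
  by exists m.+1; rewrite iter_optS /= (negbTE nb) /= Eu.
apply/card_le1_eqP => x y; rewrite !inE /= !orbF.
have pre (z : option (comp r)) :
    teta (z : tT (column_template r)) == Some None -> omap sval z = Some r.
  case: z => [b|] //=; case: (eqVneq (sval b) r) => [->|_] //.
  have [|u [-> _]] := @insub_comp r (W (sval b)); last by [].
  by rewrite (nf_rootW nf) comp_root.
move=> /pre Ex /pre Ey; move: Ex Ey; case: x => // x [Ex]; case: y => // y [Ey].
by congr Some; apply: val_inj; rewrite /= Ex Ey.
Qed.

Lemma up_root r b : root r = r -> d r = 0 -> d (root b) = 0 -> root b = r.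
Proof. by move=> rr dr db; apply: (nf_up_unique nf (nf_rootK nf b) rr db dr). Qed.

(** [G] covers the core and the rising component. Every other component splits by the residue of the
    level modulo [d r]; each residue class is one decoration, based in the core because root levels
    below [d r] map there. *)
Lemma nf_decorations (G : ggraph) (psi : gV G -> X) :
  reflects psi ->
  (forall u v, gE u v -> f (psi u) = Some (psi v)) ->
  (forall u y, f (psi u) = Some y ->
     exists u' v', [/\ psi u' = psi u, psi v' = y & gE u' v']) ->
  (forall x, (exists u, psi u = x) <->
     (exists c, kappa c = x) \/ (exists b j, d (root b) = 0 /\ gamma b j = x)) ->
  decorations_iso f G.
Proof.
move=> refl edge lift image.
(* The bound by the maximum of [d] only serves to make the set of pairs (root, residue) finite. *)
pose I : finType := {i : B * 'I_(\max_b d b) | (root i.1 == i.1) && (i.2 < d i.1)}.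
pose col (i : I) := (sval i).1; pose res (i : I) : nat := (sval i).2.
have colP i : root (col i) = col i by have /andP[/eqP] := valP i.
have resP i : res i < d (col i) by have /andP[] := valP i.
(* The default value is never taken: [fcol] shows that [f] is defined there. *)
pose sigma (i : I) (j : nat) (o : option (comp (col i))) : X :=
  if o is Some b then gamma (sval b) (res i + j * d (col i))
  else odflt (gamma (col i) 0) (f (gamma (col i) (res i + j * d (col i)))).
have fcol i j : f (gamma (col i) j) = Some (odflt (gamma (col i) 0) (f (gamma (col i) j))).
  have := nf_root nf (colP i); case: ifP => _; first by move=> [_ [c ->]].
  rewrite (leq_ltn_trans _ (resP i)) // => -[H1 H2].
  have [/H2[c ->] //|le] := ltnP j (d (col i)).
  by rewrite -(subnKC le) H1.
apply: (@decorations_iso_intro _ f G psi I (fun i => column_template (col i)) sigma) => //=.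
- by move=> i; apply: column_inward.
- move=> i; suff [c E] : exists c, f (gamma (col i) (res i)) = Some (kappa c).
    rewrite mul0n addn0 E /=.
    by have [u <-] := (proj2 (image (kappa c)) (or_introl (ex_intro _ c erefl))); exists u.
  have := nf_root nf (colP i); case: ifP => _; first by move=> [_ [c ->]]; exists c.
  by rewrite (leq_ltn_trans _ (resP i)) // => -[_ /(_ _ (resP i))].
- move=> i j; have := nf_root nf (colP i); case: ifP => _ /=.
    by move=> [_ [c Hc]]; rewrite !Hc.
  rewrite (leq_ltn_trans _ (resP i)) // => -[H1 _].
  have [|u [-> /= ->]] := @insub_comp (col i) (W (col i)).
    by rewrite (nf_rootW nf) colP.
  by rewrite mulSn addnCA H1.
- move=> i j [b|] //= y; case: eqP => [Eb [<-]|nb [<-]] /=; first by rewrite Eb fcol.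
  have [|u [-> /= ->]] := @insub_comp (col i) (W (sval b)).
    by rewrite (nf_rootW nf) comp_root.
  by rewrite (nf_step nf) // comp_root.
- move=> i j [b|] // i' j' [b'|] //= _ _ /(nf_ginj nf)[Eb E].
  have Ec : col i = col i' by rewrite -(comp_root b) -(comp_root b') Eb.
  have [|||Er Ej] := @radix_inj (d (col i)) (res i) j (res i') j' => //.
  - by rewrite Ec.
  - by rewrite E Ec.
  by apply: val_inj; apply: injective_projections => //; apply: ord_inj.
- move=> i j [b|] // j' [b'|] //= _ _ /(nf_ginj nf)[Eb E].
  have [||_ ->] := radix_inj _ _ E => //; split=> //.
  by congr Some; apply: val_inj.
- move=> i j [b|] // u _ /= E.
  have [[c Ec]|[b' [j' [E0 Eb]]]] := proj1 (image (psi u)) (ex_intro _ u erefl).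
    by case: (nf_disj nf (etrans Ec (esym E))).
  have [Ebb _] := nf_ginj nf (etrans Eb (esym E)).
  by have := resP i; rewrite -(comp_root b) -Ebb E0.
move=> x; have [[c Ec]|[b [j Ej]]] := nf_cover nf x.
  by left; apply/image; left; exists c.
have [d0|d_gt0] := posnP (d (root b)); first by left; apply/image; right; exists b, j.
right; have lt_r : j %% d (root b) < \max_b d b.
  by apply: leq_trans (leq_bigmax (root b)); rewrite ltn_mod.
have Hi : (root (root b, Ordinal lt_r).1 == (root b, Ordinal lt_r).1) &&
    ((root b, Ordinal lt_r).2 < d (root b, Ordinal lt_r).1).
  by rewrite /= (nf_rootK nf) eqxx ltn_mod.
pose i : I := exist (fun i : B * 'I_(\max_b d b) => (root i.1 == i.1) && (i.2 < d i.1))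
  (root b, Ordinal lt_r) Hi.
have Hb : root b == col i by [].
exists i, (j %/ d (root b)), (Some (exist (fun b => root b == col i) b Hb)); split=> //.
by rewrite -Ej /sigma /= addnC -divn_eq.
Qed.

(** Undefined at a sink, and also where [f] leaves the core. *)
Definition core_map (c : C) : option C :=
  if f (kappa c) is Some y then [pick c' | `[< kappa c' = y >]] else None.

Lemma core_mapP c c' : core_map c = Some c' <-> f (kappa c) = Some (kappa c').
Proof.
rewrite /core_map; split=> [|->].
  by case: (f _) => // y; case: pickP => // z /asboolP <- [->].
case: pickP => [z /asboolP /(nf_kinj nf) ->//|/(_ c')].
by case: asboolP.
Qed.

Lemma tree_reflects (R : rtree) (psi : rT R -> X) :
  injective psi -> reflects (g := tree_g R) psi.
Proof. by move=> inj; apply: discrete_reflects => [u v []|u v /inj]. Qed.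

(** No edge leaves the core, and the only iterate of the sink is itself; so by confluence every core
    vertex reaches the sink within the core. *)
Lemma nf_shape3 c0 : (forall r, root r = r -> d r <> 0) -> f (kappa c0) = None -> shape3 f.
Proof.
move=> noup sink.
have core c y : f (kappa c) = Some y -> exists c', y = kappa c'.
  by move=> /(nf_core nf)[//|[r [Er /(noup _ Er)]]].
exists (@RTree C core_map c0); split.
  split=> [|c] /=; first by rewrite /core_map sink.
  have [m [n [z [Em En]]]] := orbit_merge (proj2 orb (kappa c) (kappa c0)).
  have Ez : z = kappa c0.
    by apply: (iter_opt_closed (P := eq^~ (kappa c0)) _ En) => // u v ->; rewrite sink.
  rewrite {}Ez {En} in Em; elim: m c Em => [|m IH] c.
    by move=> [/(nf_kinj nf)->]; exists 0.
  rewrite iter_optS; case Ef: (f _) => [y|] //=.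
  have [c' Ec'] := core _ _ Ef; rewrite Ec' => /IH[l El]; exists l.+1.
  by rewrite iter_optS (proj2 (core_mapP c c')) //= Ef Ec'.
apply: (@nf_decorations (tree_g (@RTree C core_map c0)) kappa).
- exact/tree_reflects/(nf_kinj nf).
- by move=> u v /core_mapP.
- move=> u y Ey; have [c' Ec'] := core _ _ Ey.
  by exists u, c'; split=> //; apply/core_mapP; rewrite Ey Ec'.
- move=> x; split; first by left.
  by case=> // -[b [j [/noup]]]; case; apply: (nf_rootK nf).
Qed.

Section Outward.
Variables (r : B) (c0 : C).
Hypotheses (rootr : root r = r) (d0 : d r = 0).
Hypothesis exit : f (kappa c0) = Some (gamma (W r) 0).
Hypothesis exit_unique : forall c, f (kappa c) = Some (gamma (W r) 0) -> c = c0.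

(** [None] is the vertex just before column [W r]: the exit [c0] in copy 0, and entry [j] of the
    root column in copy [j.+1]. The root column is [tt1] and has no out-edge in its own copy, since
    its edge belongs to [None] of the next one. *)
Definition outward_template : template :=
  @Template (option (comp r))
    (fun o => if o is Some b then
       if sval b == r then None else Some (insub (W (sval b)))
     else Some (insub (W r)))
    None (insub r).

Let sigma (j : nat) (o : option (comp r)) : X :=
  if o is Some b then gamma (sval b) j
  else if j is j'.+1 then gamma r j' else kappa c0.

Lemma up_step j : f (gamma r j) = Some (gamma (W r) j.+1).
Proof. by have := nf_root nf rootr; rewrite d0; case: ifP => [_ []|_ ->]. Qed.

Lemma insub_W (b : comp r) : exists u : comp r, insub (W (sval b)) = Some u /\ sval u = W (sval b).
Proof. by apply: insub_comp; rewrite (nf_rootW nf) comp_root. Qed.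

Lemma outward_template_ok : outward_path_template outward_template.
Proof.
have [rh [Erh rhE]] := insub_comp rootr.
have [w [Ew wE]] := insub_W rh; rewrite rhE in Ew wE.
have reach (b : comp r) : exists n, iter_opt (@teta outward_template) n (Some b) = Some (insub r).
  have [n] := nf_reach nf (sval b); rewrite comp_root.
  elim: n b => [|n IH] b /=.
    by move=> E; exists 0; rewrite /iter_opt /= Erh; congr (Some (Some _)); apply: val_inj; rewrite /= E.
  rewrite -iterS iterSr => E; have [Eb|nb] := eqVneq (sval b) r.
    by exists 0; rewrite /iter_opt /= Erh; congr (Some (Some _)); apply: val_inj; rewrite /= Eb.
  have [u [Eu Wu]] := insub_W b.
  have [|m Em] := IH u; first by rewrite Wu.
  by exists m.+1; rewrite iter_optS /= (negbTE nb) /= Eu.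
split; first by rewrite /= Erh.
split; first split.
- by rewrite /= Erh rhE eqxx.
- move=> [b|]; first exact: reach.
  have [n En] := reach w; exists n.+1; rewrite iter_optS.
  by change (iter_opt (@teta outward_template) n (insub (W r)) = Some (insub r)); rewrite Ew.
apply/card_le1_eqP => x y; rewrite !inE /=.
have pre (z : option (comp r)) :
    (teta (z : tT outward_template) == Some None) || (Some (insub (W r)) == Some z) -> z = Some w.
  case/orP => [|/eqP[<-] //]; case: z => [b|] /=; last by rewrite Ew.
  by case: (eqVneq (sval b) r) => // _; have [u [-> _]] := insub_W b.
by move=> /pre -> /pre ->.
Qed.

(** Iterates of [gamma r 0] stay in the component of [r], so by confluence every path in the core
    must leave it, and [c0] is the only way out. *)
Lemma core_tree_ok : rtree_ok (@RTree C core_map c0).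
Proof.
split=> [|c] /=.
  rewrite /core_map exit; case: pickP => // c' /asboolP.
  by move/(nf_disj nf).
have [m [n [z [Em En]]]] := orbit_merge (proj2 orb (kappa c) (gamma r 0)).
have [b [j [_ Ez]]] : exists b j, root b = r /\ z = gamma b j.
  apply: (iter_opt_closed (P := fun z => exists b j, root b = r /\ z = gamma b j) _ En).
    move=> u v [b [j [Eb ->]]]; have [->|nb] := eqVneq b r.
      by rewrite up_step => -[<-]; exists (W r), j.+1; rewrite (nf_rootW nf).
    rewrite (nf_step nf) => [[<-]|]; last by rewrite Eb; apply/eqP.
    by exists (W b), j; rewrite (nf_rootW nf).
  by exists r, 0.
rewrite {}Ez {En} in Em; elim: m c Em => [|m IH] c.
  by move=> [/(nf_disj nf)].
rewrite iter_optS; case Ef: (f _) => [y|] //=.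
have [[c' Ec']|[r' [Er' dr' Ey]]] := nf_core nf Ef.
  rewrite Ec' => /IH[l El]; exists l.+1.
  by rewrite iter_optS (proj2 (core_mapP c c')) //= Ef Ec'.
move=> _; exists 0; rewrite /iter_opt /=; congr Some; apply: exit_unique.
by rewrite Ef Ey (nf_up_unique nf Er' rootr).
Qed.

Lemma nf_shape2 : shape2 f.
Proof.
exists (@RTree C core_map c0), outward_template; split; first exact: core_tree_ok.
split; first exact: outward_template_ok.
pose R := @RTree C core_map c0; pose O := outward_template.
pose G := @multi_attach (tree_g R) 1 (fun _ => S_g O) (fun _ => S_base O) (fun _ => rroot R).
pose psi : gV G -> X := attach_map (K := tree_g R) (P := fun _ : 'I_1 => S_g O) (p := fun _ => S_base O)
  (a := fun _ => rroot R) kappa (fun _ u => sigma u.1 u.2).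
have [rh [Erh rhE]] := insub_comp rootr.
have [w [Ew wE]] := insub_W rh; rewrite rhE in Ew wE.
have sedge j (x y : tT O) : teta x = Some y -> f (sigma j x) = Some (sigma j y).
  case: x => [b|] /=.
    case: eqP => // nb [<-]; have [u [-> /= ->]] := insub_W b.
    by rewrite (nf_step nf) // comp_root.
  by move=> [<-]; rewrite Ew /= wE; case: j => [|j]; rewrite ?exit ?up_step.
apply: (@nf_decorations G psi).
- apply: (@attach_S_reflects X (tree_g R) 1 (fun _ => O) (fun _ => rroot R) kappa (fun _ => sigma)) => //=.
  + exact/tree_reflects/(nf_kinj nf).
  + by move=> _ j; rewrite Erh /= rhE.
  + by move=> i j x i' *; rewrite (ord1 i) (ord1 i').
  + move=> _ j [b|] // j' [b'|] //= _ _ /(nf_ginj nf)[Eb ->]; split=> //.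
    by congr Some; apply: val_inj.
  + by move=> _ j [b|] //= u _ /esym/(nf_disj nf).
- move=> [u|[i u]] [v|[i' v]] //=; first by move=> /core_mapP.
  move=> H; pose g (t : {k : 'I_1 & gV (S_g O)}) := sigma (projT2 t).1 (projT2 t).2.
  rewrite -/(g (existT _ i u)) -/(g (existT _ i' v)).
  by case: H => {i i' u v} i [j x] [j' y] /= [<- Exy]; exact: sedge.
(* Two kinds of edges need another representative of their source: the exit edge starts at [None] of
   copy 0, and the edge from entry [j] of the root column at [None] of copy [j.+1]. *)
- have lift j (x z : tT O) y : teta x = Some z -> f (sigma j x) = Some y ->
      exists u' v' : gV G, [/\ psi u' = sigma j x, psi v' = y & gE u' v'].
    move=> Exz; rewrite (sedge _ _ _ Exz) => -[<-].
    exists (inr (existT _ ord0 (j, x))), (inr (existT _ ord0 (j, z))); split=> //=.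
  move=> [c|[i [j x]]] y.
    move=> Ef; have [[c' Ec']|[r' [Er' dr' Ey]]] := nf_core nf Ef.
      by exists (inl c), (inl c'); split=> //; apply/core_mapP; rewrite -Ec'.
    rewrite (nf_up_unique nf Er' rootr dr' d0) in Ey.
    have Ec : c = c0 by apply: exit_unique; rewrite -Ey.
    rewrite Ec in Ef *; exact: (lift 0 None _ y erefl Ef).
  case: x => [b|]; last exact: lift.
  have [Eb|nb] := eqVneq (sval b) r; last first.
    by apply: lift => /=; rewrite (negbTE nb).
  rewrite /psi /= Eb => Ef; exact: (lift j.+1 None _ y erefl Ef).
move=> x; split.
  move=> [[c|[i [j [b|]]]] <-] /=; first by left; exists c.
    by right; exists (sval b), j; rewrite comp_root d0.
  case: j => [|j]; first by left; exists c0.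
  by right; exists r, j; rewrite rootr d0.
case=> [[c <-]|[b [j [Ed <-]]]]; first by exists (inl c).
have [u [_ Eu]] := insub_comp (up_root rootr d0 Ed).
by exists (inr (existT _ ord0 (j, Some u))); rewrite /psi /= Eu.
Qed.
End Outward.
End NormalForm.

(** * Finite maps all of whose orbits reach one cycle *)

Lemma recurrent_exists (T : finType) (E : T -> T) (x : T) :
  exists2 y, fconnect E x y & fconnect E (E y) y.
Proof.
have /trajectP[i lt_i Ei] := looping_order E x; exists (iter i E x).
  exact: fconnect_iter.
have Ey : iter (fingraph.order E x - i).-1 E (E (iter i E x)) = iter i E x.
  by rewrite -iterS -iterSr -iterD -Ei; congr (iter _ E x); lia.
by rewrite -{2}Ey fconnect_iter.
Qed.

Section Cyclic.
Variables (T : finType) (E : T -> T) (c0 : T).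
Hypothesis recur : fconnect E (E c0) c0.
Hypothesis attract : forall c, exists n, fconnect E c0 (iter n E c).

Let n := (fingraph.order E c0).-1.

Lemma order_n : n.+1 = fingraph.order E c0.
Proof. by rewrite prednK // order_gt0. Qed.

Lemma iter_period : iter n.+1 E c0 = c0.
Proof.
rewrite order_n; apply: (iter_order_cycle (p := orbit E c0)); rewrite -?fconnect_orbit ?connect0 //.
by rewrite -fconnect_f.
Qed.

Definition entry_time (c : T) : nat := ex_minn (attract c).

(** Position, counted from [c0], where the orbit of [c] first meets the cycle. The fibres are the
    vertex sets of the attached trees. *)
Definition entry (c : T) : 'I_n.+1 := inord (findex E c0 (iter (entry_time c) E c)).

Lemma entry_on c : fconnect E c0 c -> entry c = findex E c0 c :> nat.
Proof.
move=> Hc; rewrite /entry /entry_time; case: ex_minnP => k _ /(_ 0 Hc).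
by rewrite leqn0 => /eqP->; rewrite /= inordK // order_n findex_max.
Qed.

Lemma entry_off c : ~~ fconnect E c0 c -> entry (E c) = entry c.
Proof.
move=> nc; rewrite /entry; congr inord; congr findex.
suff -> : entry_time c = (entry_time (E c)).+1 by rewrite iterSr.
rewrite /entry_time; case: ex_minnP => -[|k] Hk mink; first by rewrite Hk in nc.
case: ex_minnP => l Hl minl; apply/eqP; rewrite eqSS eqn_leq -ltnS mink ?minl //.
- by rewrite -iterSr.
- by rewrite iterSr.
Qed.

Lemma entry_iter (i : 'I_n.+1) : entry (iter i E c0) = i.
Proof.
apply: ord_inj; rewrite entry_on ?fconnect_iter // findex_iter //.
by rewrite -order_n.
Qed.

Lemma entry_onK c : fconnect E c0 c -> iter (entry c) E c0 = c.
Proof. by move=> Hc; rewrite entry_on // iter_findex. Qed.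

(** The edge of a cycle vertex is dropped, as it belongs to the cycle. *)
Definition entry_tree (i : 'I_n.+1) : rtree :=
  @RTree {c | entry c == i}
    (fun c => if fconnect E c0 (sval c) then None else insub (E (sval c)))
    (exist _ (iter i E c0) (introT eqP (entry_iter i))).

Lemma entry_insub i (c : {c | entry c == i}) : ~~ fconnect E c0 (sval c) ->
  exists u : {c | entry c == i}, insub (E (sval c)) = Some u /\ sval u = E (sval c).
Proof.
move=> nc; have H : entry (E (sval c)) == i by rewrite entry_off ?(valP c).
by exists (exist (fun c => entry c == i) _ H); rewrite (insubT (fun c => entry c == i) H).
Qed.

Lemma entry_tree_ok i : rtree_ok (entry_tree i).
Proof.
split=> [|c] /=; first by rewrite fconnect_iter.
have onP (u : {c | entry c == i}) : fconnect E c0 (sval u) -> u = rroot (entry_tree i).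
  by move=> on; apply: val_inj => /=; rewrite -[LHS](entry_onK on) (eqP (valP u)).
have [k] := attract (sval c); elim: k c => [|k IH] c Hc.
  by exists 0; rewrite [c]onP.
have [on|off] := boolP (fconnect E c0 (sval c)); first by exists 0; rewrite [c]onP.
have [u [Eu uE]] := entry_insub off.
have [|m Em] := IH u; first by rewrite uE -iterSr.
by exists m.+1; rewrite iter_optS /= (negbTE off) Eu.
Qed.
End Cyclic.

(** Without exit and sink, [f] restricts to a total map [E] of the core. A recurrent point spans a
    cycle, and by confluence every core orbit runs into it. *)
Lemma nf_shape1 (X : Type) (f : X -> option X) (C B : finType) (kappa : C -> X)
    (gamma : B -> nat -> X) (W root : B -> B) (d : B -> nat) (st : pred B) :
  normal_form f kappa gamma W root d st -> single_orbit f ->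
  (forall r, root r = r -> d r <> 0) -> (forall c, f (kappa c) <> None) ->
  shape1 f.
Proof.
move=> nf orb noup nosink.
have /choice[E HE] c : exists c', f (kappa c) = Some (kappa c').
  case Ef: (f (kappa c)) => [y|]; last by case: (nosink c).
  by have [[c' ->]|[r [Er /(noup _ Er)]]] // := nf_core nf Ef; exists c'.
have [c1 _] : exists c : C, True.
  have [[x] _] := orb; have [[c _]|[b _]] := nf_cover nf x; first by exists c.
  have := nf_root nf (nf_rootK nf b); case: ifP => _; first by move=> [_ [c _]]; exists c.
  case: posnP => [/noup[]|lt_d [_ /(_ _ lt_d)[c _]]]; [exact: (nf_rootK nf)|by exists c].
have [c0 _ recur] := recurrent_exists E c1.
have attract c : exists n, fconnect E c0 (iter n E c).
  have clos x (P := fun y => exists n, y = kappa (iter n E x)) u v : P u -> f u = Some v -> P v.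
    by move=> [n ->]; rewrite HE => -[<-]; exists n.+1.
  have [||z [[n Ez] [m Ez']]] := @closed_meet _ _ orb _ _ (kappa c) (kappa c0) (clos c) (clos c0).
  - by exists 0.
  - by exists 0.
  exists n; rewrite -(_ : iter m E c0 = iter n E c) ?fconnect_iter //.
  by apply: (nf_kinj nf); rewrite -Ez -Ez'.
pose n := (fingraph.order E c0).-1; pose P := entry_tree attract.
exists n, n.+1, P, id; split; first by move=> i; apply: entry_tree_ok.
pose p i : gV (tree_g (P i)) := rroot (P i).
pose psi := attach_map (K := cycle_g n) (P := fun i => tree_g (P i)) (p := p) (a := id)
  (fun i : 'I_n.+1 => kappa (iter i E c0)) (fun i (c : rT (P i)) => kappa (sval c)).
have ent i (c : rT (P i)) : entry attract (sval c) = i by apply/eqP/(valP c).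
have off_lift c : ~~ fconnect E c0 c ->
    exists u v, [/\ psi u = kappa c, psi v = kappa (E c) & gE u v].
  move=> nc; have H : entry attract c == entry attract c by [].
  pose u : rT (P (entry attract c)) := exist (fun x => entry attract x == entry attract c) c H.
  have [v [Ev vE]] := entry_insub (c := u) nc.
  exists (inr (existT _ (entry attract c) u)), (inr (existT _ (entry attract c) v)); split=> //=.
    by rewrite vE.
  by apply: (@sigrel_in _ (fun i => tree_g (P i))); rewrite /= (negbTE nc).
have on_lift c : fconnect E c0 c ->
    exists u v, [/\ psi u = kappa c, psi v = kappa (E c) & gE u v].
  move=> oc; have lt : (entry attract c).+1 %% n.+1 < n.+1 by rewrite ltn_mod.
  exists (inl (entry attract c)), (inl (Ordinal lt)); split=> //=; first by rewrite entry_onK.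
  congr kappa; rewrite -{2}(entry_onK attract oc) -iterS.
  have := ltn_ord (entry attract c); rewrite leq_eqVlt => /orP[/eqP->|lt'].
    by rewrite modnn iter_period.
  by rewrite modn_small.
have edge_cycle (i j : 'I_n.+1) : val j = (val i).+1 %% n.+1 ->
    E (iter i E c0) = iter j E c0.
  move=> /= ->; rewrite -iterS; have := ltn_ord i; rewrite leq_eqVlt => /orP[/eqP->|lt'].
    by rewrite modnn iter_period.
  by rewrite modn_small.
apply: (nf_decorations nf (psi := psi)).
- apply: attach_reflects.
  + apply: discrete_reflects => [u v []|i j /(nf_kinj nf) Eij].
    by rewrite -(entry_iter attract i) Eij entry_iter.
  + move=> i; apply: discrete_reflects => [u v []|u v /(nf_kinj nf) Euv].
    exact: val_inj.
  + by [].
  + move=> i u v /(nf_kinj nf) Euv; rewrite (_ : u = p i); first exact: rst_refl.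
    apply: val_inj; rewrite /= Euv; congr iter.
    by rewrite -(ent _ u) Euv entry_iter.
  + by move=> i i' u v /(nf_kinj nf) Euv; left; rewrite -(ent _ u) -(ent _ v) Euv.
- move=> [u|[i u]] [v|[i' v]] //=.
    by move=> /edge_cycle <-; rewrite HE.
  move=> H; pose g (t : {k : 'I_n.+1 & gV (tree_g (P k))}) := kappa (sval (projT2 t)).
  rewrite -/(g (existT _ i u)) -/(g (existT _ i' v)).
  case: H => {i i' u v} i u v /=; rewrite /g /=; case: ifP => // /negbT nu.
  have [w [-> wE]] := entry_insub nu.
  by move=> [<-]; rewrite wE HE.
- have imC u : exists c, psi u = kappa c.
    by case: u => [i|[i c]]; [exists (iter i E c0)|exists (sval c)].
  move=> u y; have [c ->] := imC u; rewrite HE => -[<-].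
  by case: (boolP (fconnect E c0 c)) => [/on_lift|/off_lift].
move=> x; split.
  by case=> -[i|[i c]] <-; left; [exists (iter i E c0)|exists (sval c)].
case=> [[c <-]|[b [j [/noup[]]]]]; last exact: (nf_rootK nf).
have H : entry attract c == entry attract c by [].
by exists (inr (existT _ (entry attract c) (exist (fun x => entry attract x == entry attract c) c H))).
Qed.

(** * From periodic models to normal forms *)

(** [rep t] depends on [g t] alone, so its fixed points contain one preimage of each value. *)
Lemma finite_image (T : finType) (X : Type) (g : T -> X) :
  exists (C : finType) (kappa : C -> X), injective kappa /\
    forall x, (exists t, g t = x) <-> (exists c, kappa c = x).
Proof.
pose rep t := odflt t [pick t' | `[< g t' = g t >]].
have repE t : g (rep t) = g t.
  by rewrite /rep; case: pickP => [t' /asboolP|].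
have rep_eq t t' : g t = g t' -> rep t = rep t'.
  move=> E; rewrite /rep E; case: pickP => // /(_ t').
  by case: asboolP.
exists {t | rep t == t}, (fun c => g (sval c)); split.
  move=> [t /= Ht] [t' /= Ht'] /= /rep_eq E; apply: val_inj => /=.
  by rewrite -(eqP Ht) -(eqP Ht') E.
move=> x; split=> [[t <-]|[c <-]]; last by exists (sval c).
have H : rep (rep t) == rep t by apply/eqP/rep_eq/repE.
by exists (exist (fun t => rep t == t) _ H); rewrite /= repE.
Qed.

(** * Offsets absorbing the shifts of non-root columns *)

Section Offsets.
Variables (B : finType) (W : B -> B) (s : B -> nat).

(** Some point of the cycle that [b] runs into. The predicate has the same extension at [b] and at
    [W b], so [pick] selects one point per component. *)
Definition column_root (b : B) : B :=
  odflt b [pick y | fconnect W b y && fconnect W (W y) y].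

Lemma column_rootP b : fconnect W b (column_root b).
Proof. by rewrite /column_root; case: pickP => [y /andP[]|] //= _; apply: connect0. Qed.

Lemma column_rootW b : column_root (W b) = column_root b.
Proof.
have E : (fun y => fconnect W (W b) y && fconnect W (W y) y) =1
    (fun y => fconnect W b y && fconnect W (W y) y).
  move=> y; rewrite (fconnect_eqVf W b); case: eqP => //= ->.
  by rewrite andbb.
rewrite /column_root (eq_pick E); case: pickP => // none.
by have [y H1 H2] := recurrent_exists W b; have := none y; rewrite H1 H2.
Qed.

Lemma column_rootK b : column_root (column_root b) = column_root b.
Proof.
rewrite -{1}(iter_findex (column_rootP b)).
by elim: (findex _ _ _) => //= k IH; rewrite column_rootW.
Qed.

Lemma column_root_fixed b : W b = b -> column_root b = b.
Proof.
move=> Wb; rewrite -(iter_findex (column_rootP b)).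
by elim: (findex _ _ _) => //= k ->.
Qed.

Fixpoint total_shift (k : nat) (b : B) : nat :=
  if k is k'.+1 then s b + total_shift k' (W b) else 0.

(* [column_time b] steps of [W] lead from [b] to its root and shift the position
   along the column by [total_shift _ b - column_time b]. *)
Definition column_time (b : B) : nat := findex W b (column_root b).

(** Solves the equation of [column_offset_step], by which a step from a non-root column preserves
    the level counted from the offset. The term [2 * #|B|] bounds the total shift, so the offset
    stays above [H]. *)
Definition column_offset (H : nat) (b : B) : nat :=
  H + 2 * #|B| + column_time b - total_shift (column_time b) b.

Hypothesis s_le2 : forall b, s b <= 2.

Lemma total_shift_le k b : total_shift k b <= 2 * k.
Proof. by elim: k b => //= k IH b; have := IH (W b); have := s_le2 b; lia. Qed.

Lemma column_time_le b : column_time b <= #|B|.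
Proof. exact: leq_trans (ltnW (findex_max (column_rootP b))) (max_card _). Qed.

Lemma column_offset_ge H b : H <= column_offset H b.
Proof.
rewrite /column_offset; have := total_shift_le (column_time b) b.
by have := column_time_le b; lia.
Qed.

Lemma column_offset_step H b : b <> column_root b ->
  column_offset H b + s b = (column_offset H (W b)).+1.
Proof.
move=> /eqP nb; rewrite /column_offset; have := column_time_le b.
have -> : column_time b = (column_time (W b)).+1.
  by rewrite /column_time column_rootW fconnect_findex ?column_rootP // eq_sym.
have := total_shift_le (column_time (W b)).+1 b.
rewrite /=.
have := total_shift_le (column_time (W b)) (W b).
by lia.
Qed.
End Offsets.

Lemma model_normal_form (X : Type) (f : X -> option X) (A B : finType)
    (alpha : A -> X) (beta : B -> nat -> X) :
  single_orbit f -> periodic_model f alpha beta ->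
  exists (C : finType) (kappa : C -> X) (gamma : B -> nat -> X) (W root : B -> B)
    (d : B -> nat) (st : pred B), normal_form f kappa gamma W root d st.
Proof.
move=> orb [cover binj disj class].
(* A column with a constant target is sent to itself by [W], which makes it the root of its
   component. *)
have /choice[w Hw] b : exists w : B * nat * option X, w.1.2 <= 2 /\
    if w.2 is Some c then w.1.1 = b /\ (forall j, 0 < j -> f (beta b j) = Some c)
    else forall j, 0 < j -> f (beta b j) = Some (beta w.1.1 (j + w.1.2).-1).
  have [[c Hc]|[b' [s [le_s Hs]]]] := class b; first by exists (b, 0, Some c).
  by exists (b', s, None).
pose W b := (w b).1.1; pose s b := (w b).1.2; pose st b := isSome (w b).2.
have s_le2 b : s b <= 2 by have [] := Hw b.
have shiftE b j : ~~ st b -> 0 < j -> f (beta b j) = Some (beta (W b) (j + s b).-1).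
  by rewrite /st; have [_] := Hw b; case: (w b).2 => // H _; apply: H.
pose low m x := (exists a, alpha a = x) \/ (exists b j, j < m /\ beta b j = x).
have lowP x : exists H, forall m, H <= m -> low m x.
  have [Hx|[b [j <-]]] := cover x; first by exists 0 => m _; left.
  by exists j.+1 => m lt_m; right; exists b, j.
have lowf x : exists H, forall m, H <= m -> forall y, f x = Some y -> low m y.
  case: (f x) => [y|]; last by exists 0.
  by have [H HH] := lowP y; exists H => m /HH Hm _ [<-].
have [H1 HH1] := fin_bound (fun a => lowf (alpha a)).
have [H2 HH2] := fin_bound (fun b => lowf (beta b 0)).
have [H3 HH3] : exists H, forall b m, H <= m -> st b ->
    exists2 c, low m c & forall j, 0 < j -> f (beta b j) = Some c.
  apply: fin_bound => b; rewrite /st; have [_] := Hw b.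
  case: (w b).2 => [c [_ Hc]|_]; last by exists 0.
  by have [H HH] := lowP c; exists H => m /HH Hm _; exists c.
(* Above [H1], [H2] and [H3], all irregular targets fall into the core. The extra 2 keeps the last
   core entry of a column at a positive level, where the shift law holds. *)
pose root := column_root W; pose H0 := H1 + H2 + H3 + 2.
have [off [off_ge off_step]] : exists off : B -> nat, (forall b, H0 <= off b) /\
    forall b, b <> root b -> off b + s b = (off (W b)).+1.
  exists (column_offset W s H0); split=> b.
    exact: column_offset_ge.
  exact: column_offset_step.
have rootW b : root (W b) = root b := column_rootW W b.
have rootK b : root (root b) = root b := column_rootK W b.
have st_root b : st b -> root b = b.
  rewrite /st; have [_] := Hw b; case E: (w b).2 => [c|] // [Wb _] _.
  exact: column_root_fixed.
pose coreT : finType := (A + {b : B & 'I_(off b)})%type.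
pose core0 (t : coreT) : X := match t with
  | inl a => alpha a | inr (existT b j) => beta b j end.
have [C [kappa [kinj kimage]]] := finite_image core0.
have coreP x : (exists c, kappa c = x) <->
    (exists a, alpha a = x) \/ (exists b j, j < off b /\ beta b j = x).
  rewrite -kimage; split=> [[[a|[b j]] <-]|[[a <-]|[b [j [lt_j <-]]]]].
  - by left; exists a.
  - by right; exists b, j.
  - by exists (inl a).
  - by exists (inr (existT _ b (Ordinal lt_j))).
have core_low m x : m <= H0 -> low m x -> exists c, x = kappa c.
  move=> le_m Hx; suff [c <-] : exists c, kappa c = x by exists c.
  apply/coreP; case: Hx => [|[b [j [lt_j Ex]]]]; [by left|right].
  by exists b, j; split=> //; have := off_ge b; lia.
have core_beta b j : j < off b -> exists c, beta b j = kappa c.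
  move=> lt_j; suff [c <-] : exists c, kappa c = beta b j by exists c.
  by apply/coreP; right; exists b, j.
pose gamma b j := beta b (off b + j).
have ginj b j b' j' : gamma b j = gamma b' j' -> b = b' /\ j = j'.
  by move=> /binj[-> /addnI].
have kdisj c b j : kappa c <> gamma b j.
  move=> E; have [[a Ea]|[b' [j' [lt_j Eb]]]] := proj1 (coreP _) (ex_intro _ c E).
    exact: disj Ea.
  by have [Ebb Ej] := binj _ _ _ _ Eb; rewrite Ebb Ej in lt_j; lia.
have gshift b j : ~~ st b -> f (gamma b j) = Some (beta (W b) (off b + j + s b).-1).
  by move=> nst; rewrite shiftE //; have := off_ge b; lia.
have gstep b j : b <> root b -> f (gamma b j) = Some (gamma (W b) j).
  move=> nb; rewrite gshift; last by apply/negP => /st_root E; apply: nb.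
  by congr (Some (beta _ _)); have := off_step b nb; lia.
(* A component whose shift does not decrease the level carries as many disjoint
   forward-closed families as the shift indicates, so the shift must be 1. *)
have up_shift r : root r = r -> ~~ st r -> off (W r) < off r + s r ->
    off r + s r = (off (W r)).+2.
  move=> rr nst lt; pose e := off r + s r - (off (W r)).+1.
  pose P q x := exists b k, root b = r /\ x = gamma b (e * k + q).
  have clos q u v : P q u -> f u = Some v -> P q v.
    move=> [b [k [Eb ->]]]; have [->|/eqP nb] := eqVneq b r.
      rewrite gshift // => -[<-]; exists (W r), k.+1; split; first by rewrite rootW.
      by congr beta; rewrite mulnS /e; lia.
    rewrite gstep => [[<-]|]; last by rewrite Eb.
    by exists (W b), k; rewrite rootW.
  have [||z [[b [k [_ ->]]] [b' [k' [_ /ginj[_]]]]]] :=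
      @closed_meet _ _ orb (P 0) (P 1) (gamma r 0) (gamma r 1) (clos 0) (clos 1).
  - by exists r, 0; rewrite muln0.
  - by exists r, 0; rewrite muln0.
  move=> Ek; have : e * (k - k') = 1 by rewrite mulnBr; lia.
  by move/eqP; rewrite muln_eq1 => /andP[/eqP Ee _]; rewrite /e in Ee; lia.
(* Net descent of the step from a root, truncated at 0; a star counts as one family. Where it
   vanishes without a star, [up_shift] gives a rise of exactly one level. *)
pose d b := if st b then 1 else (off (W b)).+1 - (off b + s b).
have up_st r : d r = 0 -> ~~ st r by rewrite /d; case: (st r).
have up_lt r : d r = 0 -> off (W r) < off r + s r.
  by rewrite /d; case: (st r) => //; lia.
have up_eq r : root r = r -> d r = 0 -> off r + s r = (off (W r)).+2.
  by move=> rr dr; apply: up_shift; [|apply: up_st|apply: up_lt].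
have up_unique r r' : root r = r -> root r' = r' -> d r = 0 -> d r' = 0 -> r = r'.
  move=> rr rr' dr dr'; pose P q x := exists b k, root b = q /\ x = gamma b k.
  have clos q u v : root q = q -> d q = 0 -> P q u -> f u = Some v -> P q v.
    move=> qq dq [b [k [Eb ->]]]; have [->|/eqP nb] := eqVneq b q.
      rewrite gshift ?up_st // => -[<-]; exists (W q), k.+1; split; first by rewrite rootW.
      by congr beta; have := up_eq q qq dq; lia.
    rewrite gstep => [[<-]|]; last by rewrite Eb.
    by exists (W b), k; rewrite rootW.
  have [||z [[b [k [<- ->]]] [b' [k' [<- /ginj[-> _]]]]]] //:=
      @closed_meet _ _ orb (P r) (P r') (gamma r 0) (gamma r' 0)
      (fun u v => clos r u v rr dr) (fun u v => clos r' u v rr' dr').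
  - by exists r, 0.
  - by exists r', 0.
have core_step c y : f (kappa c) = Some y -> (exists c', y = kappa c') \/
    exists r, [/\ root r = r, d r = 0, y = gamma (W r) 0 & kappa c = beta r (off r).-1].
  have [[a <-]|[b [j [lt_j <-]]]] := proj1 (coreP (kappa c)) (ex_intro _ c erefl).
    by move=> /(HH1 a H1 (leqnn _)) Hy; left; apply: core_low Hy; rewrite /H0; lia.
  have [->|j_gt0] := posnP j.
    by move=> /(HH2 b H2 (leqnn _)) Hy; left; apply: core_low Hy; rewrite /H0; lia.
  have [stb|nst] := boolP (st b).
    have [c' Hc' ->] := HH3 b H3 (leqnn _) stb => // -[<-].
    by left; apply: core_low Hc'; rewrite /H0; lia.
  rewrite shiftE // => -[<-]; have [lt|le] := ltnP (j + s b).-1 (off (W b)).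
    by left; apply: core_beta.
  (* By [off_step], core entries of a non-root column map below the offset of the next column, so
     only a root can leave the core. *)
  have rb : root b = b.
    by apply: contrapT => nb; have := off_step b (fun E => nb (esym E)); lia.
  have Eb : off b + s b = (off (W b)).+2 by apply: up_shift => //; lia.
  right; exists b; split=> //.
  - by rewrite /d (negbTE nst); lia.
  - by congr beta; lia.
  - by congr beta; lia.
exists C, kappa, gamma, W, root, d, st; split=> //.
- move=> x; have [Hx|[b [j <-]]] := cover x; first by left; apply/coreP; left.
  have [lt|le] := ltnP j (off b); first by left; apply/coreP; right; exists b, j.
  by right; exists b, (j - off b); rewrite /gamma subnKC.
- by move=> b; exists (findex W b (root b)); rewrite iter_findex // column_rootP.
- move=> r rr; case: (boolP (st r)) => [str|nst].
    split; first by rewrite /d str.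
    have [c Hc fc] := HH3 r H3 (leqnn _) str.
    have [|c' Ec'] := core_low H3 c _ Hc; first by rewrite /H0; lia.
    by exists c' => j; rewrite fc -?Ec' //; have := off_ge r; rewrite /H0; lia.
  case: posnP => [dr j|d_gt0].
    by rewrite gshift //; congr (Some (beta _ _)); have := up_eq r rr dr; lia.
  have Ed : (off (W r)).+1 = d r + (off r + s r).
    by rewrite /d (negbTE nst) in d_gt0 *; lia.
  split=> j; first by rewrite gshift //; congr (Some (beta _ _)); lia.
  move=> lt_j; rewrite gshift //.
  have [|c ->] := core_beta (W r) (off r + j + s r).-1; last by exists c.
  by have := off_ge r; rewrite /H0; lia.
- by move=> c y /core_step[?|[r [? ? ? _]]]; [left|right; exists r].
- move=> r rr dr; have [|c0 Ec0] := core_beta r (off r).-1.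
    by have := off_ge r; rewrite /H0; lia.
  have [ge2 Er] : 2 <= off r /\ off r + s r = (off (W r)).+2.
    by split; [have := off_ge r; rewrite /H0; lia | apply: up_eq].
  exists c0; split.
    rewrite -Ec0 shiftE ?up_st //; last by lia.
    by congr (Some (beta _ _)); lia.
  move=> c /core_step[[c' /esym/kdisj//]|[r' [rr' dr' _ Ec]]].
  by apply: kinj; rewrite Ec -Ec0 (up_unique r' r).
Qed.

(** A root with [d r = 0] gives the outward path. Otherwise no edge leaves the core, which is a tree
    if it contains a sink and has a cycle if it does not. *)
Theorem theorem7p3 (X : Type) (f : X -> option X) :
  single_orbit f ->
  (unary_FA_presentable f <-> (shape1 f \/ shape2 f \/ shape3 f)).
Proof.
move=> orb; split.
  move=> /FA_nat_presentation[nu [N [p]]] /(nat_presentation_model orb)[A [B [alpha [beta]]]].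
  move=> /(model_normal_form orb)[C [kappa [gamma [W [root [d [st nf]]]]]]].
  have [[r [rr dr]]|noup] := EM (exists r, root r = r /\ d r = 0).
    by have [c0 [exit uniq]] := nf_exit nf rr dr; right; left; exact: (nf_shape2 nf orb rr dr exit uniq).
  have {}noup r : root r = r -> d r <> 0 by move=> rr dr; apply: noup; exists r.
  have [[c0 sink]|nosink] := EM (exists c, f (kappa c) = None).
    by right; right; exact: (nf_shape3 nf orb noup sink).
  by left; apply: (nf_shape1 nf orb noup) => c Ec; apply: nosink; exists c.
move=> /shape_model[A [B [alpha [beta model]]]].
exact/FA_nat_presentation/(model_nat_presentation model).
Qed.
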